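(* Let $\Gamma_8=\langle a,b\mid b^{-1}aba^{-1}bab^{-1}a^{-1}ba^{-1}\rangle$ and let $\rho_0:\Gamma_8\to \mathrm{SU}(2,1)\subset \mathrm{Sp}(2,1)$ be the representation defined by $$\rho_0(a)=\begin{pmatrix}1&1&\frac{-1-i\sqrt3}{2}\\0&1&-1\\0&0&1\end{pmatrix},\qquad \rho_0(b)=\begin{pmatrix}1&0&0\\1&1&0\\\frac{-1-i\sqrt3}{2}&-1&1\end{pmatrix}.$$ Then every small deformation of $\rho_0:\Gamma_8\to\mathrm{Sp}(2,1)$ is conjugate to a representation into $\mathrm{U}(2,1)$; that is, there is a neighbourhood $\mathcal{V}$ of $\rho_0$ in $\mathrm{Hom}(\Gamma_8,\mathrm{Sp}(2,1))$ such that for every $\rho\in\mathcal{V}$ there exists $g\in\mathrm{Sp}(2,1)$ with $g\rho(\gamma)g^{-1}\in\mathrm{U}(2,1)$ for all $\gamma\in\Gamma_8$.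
   Context: Let $J=\begin{pmatrix}0&0&1\\0&1&0\\1&0&0\end{pmatrix}$, which has signature $(2,1)$. $\mathrm{U}(2,1)=\{g\in \mathrm{GL}(3,\mathbb{C}) : g^*Jg=J\}$, $\mathrm{SU}(2,1)$ is its subgroup of determinant-one elements, and $\mathrm{Sp}(2,1)=\{g\in\mathrm{GL}(3,\mathbb{H}): g^*Jg=J\}$, where $\mathbb{H}$ denotes the quaternions and $g^*$ the conjugate transpose; the inclusion $\mathbb{C}\subset\mathbb{H}$ gives $\mathrm{SU}(2,1)\subset\mathrm{U}(2,1)\subset\mathrm{Sp}(2,1)$. $\Gamma_8$ is the fundamental group of the figure eight knot complement. For $\Gamma$ generated by $n$ elements, $\mathrm{Hom}(\Gamma,G)\subset G^n$ (via the images of the generators) carries the subspace topology. *)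

(* Defs.v *)
From HB Require Import structures.
From mathcomp Require Import all_boot all_order all_algebra.
From mathcomp Require Import generic_quotient ring.
From mathcomp Require Import complex.
From mathcomp Require Import all_classical all_reals all_analysis.

Set Implicit Arguments.
Unset Strict Implicit.
Unset Printing Implicit Defensive.

Import Order.TTheory GRing.Theory Num.Theory.
Import numFieldNormedType.Exports.

Local Open Scope quotient_scope.
Local Open Scope ring_scope.

(* The letter (x, false) is the generator x and (x, true) its inverse. *)
Definition word (X : Type) := seq (X * bool).

Section PresentedGroup.
Variables (X : choiceType) (rels : seq (word X)).

Inductive word_equiv : word X -> word X -> Prop :=
| WeqRefl u : word_equiv u u
| WeqSym u v : word_equiv u v -> word_equiv v u
| WeqTrans u v w : word_equiv u v -> word_equiv v w -> word_equiv u w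
| WeqCancel u v x e :
    word_equiv (u ++ [:: (x, e); (x, ~~ e)] ++ v) (u ++ v)
| WeqRel u v r : r \in rels -> word_equiv (u ++ r ++ v) (u ++ v).

Definition word_eqb (u v : word X) : bool := `[< word_equiv u v >].

Lemma word_eqb_equiv : equiv_class_of word_eqb.
Proof.
split.
- by move=> u; apply/asboolP; exact: WeqRefl.
- by move=> u v; apply/asboolP/asboolP; exact: WeqSym.
- by move=> v u w /asboolP uv /asboolP vw; apply/asboolP; exact: WeqTrans uv vw.
Qed.

Canonical word_equiv_rel := EquivRelPack word_eqb_equiv.

Definition pres_group := {eq_quot word_equiv_rel}.

HB.instance Definition _ := Choice.on pres_group.
HB.instance Definition _ := EqQuotient.on pres_group.

Definition pres_class (u : word X) : pres_group := \pi_pres_group u.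

Lemma pres_classP u v : pres_class u = pres_class v <-> word_equiv u v.
Proof.
split; first by move=> /eqmodP /asboolP.
by move=> uv; apply/eqmodP/asboolP.
Qed.

Lemma pres_class_repr (x : pres_group) : pres_class (repr x) = x.
Proof. exact: reprK. Qed.

Lemma word_equiv_ctx p q u v :
  word_equiv u v -> word_equiv (p ++ u ++ q) (p ++ v ++ q).
Proof.
elim=> {u v} [u|u v _|u v w _ + _|u v x e|u v r rR].
- exact: WeqRefl.
- exact: WeqSym.
- exact: WeqTrans.
- rewrite -!catA (catA p u) (catA p u (v ++ q)).
  by have := WeqCancel (p ++ u) (v ++ q) x e.
- rewrite -!catA (catA p u) (catA p u (v ++ q)).
  exact: WeqRel.
Qed.

Lemma word_equiv_cat u u' v v' :
  word_equiv u u' -> word_equiv v v' -> word_equiv (u ++ v) (u' ++ v').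
Proof.
move=> uu' vv'; apply: (@WeqTrans _ (u' ++ v)).
  exact: (word_equiv_ctx [::] v).
by have := word_equiv_ctx u' [::] vv'; rewrite !cats0.
Qed.

Definition inv_word (u : word X) : word X :=
  rev [seq (l.1, ~~ l.2) | l <- u].

Lemma inv_word_cat u v : inv_word (u ++ v) = inv_word v ++ inv_word u.
Proof. by rewrite /inv_word map_cat rev_cat. Qed.

Lemma inv_wordK : involutive inv_word.
Proof.
move=> u; rewrite /inv_word map_rev revK -map_comp -[RHS]map_id.
by apply: eq_map => -[x e] /=; rewrite negbK.
Qed.

Lemma word_equivV u : word_equiv (u ++ inv_word u) [::].
Proof.
elim/last_ind: u => [|u [x e] IHu]; first exact: WeqRefl.
rewrite -cats1 inv_word_cat -catA.
exact: WeqTrans (WeqCancel u (inv_word u) x e) IHu.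
Qed.

Lemma word_equivVl u : word_equiv (inv_word u ++ u) [::].
Proof. by have := word_equivV (inv_word u); rewrite inv_wordK. Qed.

Lemma word_equiv_inv u v :
  word_equiv u v -> word_equiv (inv_word u) (inv_word v).
Proof.
move=> uv; apply: (@WeqTrans _ (inv_word u ++ v ++ inv_word v)).
  have := word_equiv_ctx (inv_word u) [::] (word_equivV v).
  by rewrite !cats0 => /WeqSym.
have /WeqTrans : word_equiv (inv_word u ++ v ++ inv_word v)
                            (inv_word u ++ u ++ inv_word v).
  exact/word_equiv_ctx/WeqSym.
apply; rewrite catA.
exact: (word_equiv_ctx [::] (inv_word v) (word_equivVl u)).
Qed.

Definition pres_one : pres_group := pres_class [::].
Definition pres_mul (x y : pres_group) := pres_class (repr x ++ repr y).
Definition pres_inv (x : pres_group) := pres_class (inv_word (repr x)).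

Lemma pres_mulE u v :
  pres_mul (pres_class u) (pres_class v) = pres_class (u ++ v).
Proof.
by apply/pres_classP; apply: word_equiv_cat; apply/pres_classP;
  rewrite pres_class_repr.
Qed.

Lemma pres_invE u : pres_inv (pres_class u) = pres_class (inv_word u).
Proof.
by apply/pres_classP/word_equiv_inv/pres_classP; rewrite pres_class_repr.
Qed.

Lemma pres_ind (P : pres_group -> Prop) :
  (forall u, P (pres_class u)) -> forall x, P x.
Proof. by move=> Pu x; rewrite -(pres_class_repr x). Qed.

Lemma pres_mulA : associative pres_mul.
Proof.
elim/pres_ind=> u; elim/pres_ind=> v; elim/pres_ind=> w.
by rewrite !pres_mulE catA.
Qed.

Lemma pres_mul1 : left_id pres_one pres_mul.
Proof. by elim/pres_ind=> u; rewrite pres_mulE. Qed.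

Lemma pres_mulr1 : right_id pres_one pres_mul.
Proof. by elim/pres_ind=> u; rewrite pres_mulE cats0. Qed.

Lemma pres_mulV : left_inverse pres_one pres_inv pres_mul.
Proof.
elim/pres_ind=> u; rewrite pres_invE pres_mulE.
exact/pres_classP/word_equivVl.
Qed.

Lemma pres_mulrV : right_inverse pres_one pres_inv pres_mul.
Proof.
elim/pres_ind=> u; rewrite pres_invE pres_mulE.
exact/pres_classP/word_equivV.
Qed.

HB.instance Definition _ := isGroup.Build pres_group
  pres_mulA pres_mul1 pres_mulr1 pres_mulV pres_mulrV.

Definition pres_gen (x : X) : pres_group := pres_class [:: (x, false)].

Section Lift.
Variables (G : groupType) (f : X -> G).

Definition eval_word (u : word X) : G :=
  (\prod_(l <- u) (if l.2 then (f l.1)^-1 else f l.1))%g.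

Lemma eval_word_cat u v : eval_word (u ++ v) = (eval_word u * eval_word v)%g.
Proof. by rewrite /eval_word big_cat. Qed.

Hypothesis f_rels : {in rels, forall r, eval_word r = 1%g}.

Lemma eval_word_equiv u v : word_equiv u v -> eval_word u = eval_word v.
Proof.
elim=> {u v} [//|//|u v w _ -> _ //|u v x e|u v r rR].
- rewrite !eval_word_cat; congr (_ * _)%g; rewrite -[RHS]mul1g; congr (_ * _)%g.
  rewrite /eval_word big_cons big_seq1 /=.
  by case: e => /=; rewrite ?mulgV ?mulVg.
- by rewrite !eval_word_cat (f_rels rR) mul1g.
Qed.

Definition pres_lift (x : pres_group) : G := eval_word (repr x).

Lemma pres_lift_class u : pres_lift (pres_class u) = eval_word u.
Proof.
by apply: eval_word_equiv; apply/pres_classP; rewrite pres_class_repr.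
Qed.

Lemma pres_liftM : {morph pres_lift : x y / (x * y)%g >-> (x * y)%g}.
Proof.
elim/pres_ind=> u; elim/pres_ind=> v.
by rewrite -[(_ * _)%g]/(pres_mul _ _) pres_mulE !pres_lift_class eval_word_cat.
Qed.

Lemma pres_lift_gen x : pres_lift (pres_gen x) = f x.
Proof. by rewrite pres_lift_class /eval_word big_seq1. Qed.

End Lift.
End PresentedGroup.

HB.mixin Record isStarRing K of GRing.NzRing K := {
  star : K -> K;
  starD : {morph star : x y / x + y};
  starM : forall x y : K, star (x * y) = star y * star x;
  starK : involutive star
}.

#[short(type="starRingType")]
HB.structure Definition StarRing := {K of isStarRing K & GRing.NzRing K}.

Section StarRingTheory.
Variable K : starRingType.
Implicit Types x y : K.

Lemma star0 : star (0 : K) = 0.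
Proof. by apply: (addrI (star (0 : K))); rewrite -starD !addr0. Qed.

Lemma star1 : star (1 : K) = 1.
Proof. by rewrite -[LHS]mul1r -[X in X * _]starK -starM mul1r starK. Qed.

Lemma star_sum I (r : seq I) (P : pred I) (F : I -> K) :
  star (\sum_(i <- r | P i) F i) = \sum_(i <- r | P i) star (F i).
Proof. exact: (big_morph star (@starD K) star0). Qed.

Definition adjmx m n (M : 'M[K]_(m, n)) : 'M[K]_(n, m) := (map_mx star M)^T.

Lemma adjmxM m n p (M : 'M[K]_(m, n)) (N : 'M[K]_(n, p)) :
  adjmx (M *m N) = adjmx N *m adjmx M.
Proof.
apply/matrixP => i j; rewrite !mxE star_sum; apply: eq_bigr => k _.
by rewrite !mxE starM.
Qed.

Lemma adjmxK m n : cancel (@adjmx m n) (@adjmx n m).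
Proof. by move=> M; apply/matrixP => i j; rewrite !mxE starK. Qed.

Lemma adjmx1 n : adjmx (1%:M : 'M[K]_n) = 1%:M.
Proof.
by apply/matrixP => i j; rewrite !mxE eq_sym; case: eqP; rewrite ?star1 ?star0.
Qed.

End StarRingTheory.

Definition mx3 (K : Type) (a b c d e f g h i : K) : 'M[K]_3 :=
  \matrix_(k < 3, l < 3)
    nth a (nth [::] [:: [:: a; b; c]; [:: d; e; f]; [:: g; h; i]] k) l.

Section Isometries.
Variable K : starRingType.
Implicit Types g : 'M[K]_3.

Definition formJ : 'M[K]_3 :=
  mx3 0 0 1
      0 1 0
      1 0 0.

(* K may be noncommutative, so that GL(3, K) is the set of matrices with a
   two-sided inverse. *)
Definition GL3 g : Prop := exists h, h *m g = 1%:M /\ g *m h = 1%:M.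

Definition isometryJ : {pred 'M[K]_3} :=
  fun g => `[< GL3 g /\ adjmx g *m formJ *m g = formJ >].

Definition isoJ := {g : 'M[K]_3 | g \in isometryJ}.

HB.instance Definition _ := SubType.on isoJ.
HB.instance Definition _ := [Choice of isoJ by <:].

Lemma mx3M (a b c d e f g h i a' b' c' d' e' f' g' h' i' : K) :
  mx3 a b c d e f g h i *m mx3 a' b' c' d' e' f' g' h' i' =
  mx3 (a * a' + b * d' + c * g') (a * b' + b * e' + c * h')
      (a * c' + b * f' + c * i')
      (d * a' + e * d' + f * g') (d * b' + e * e' + f * h')
      (d * c' + e * f' + f * i')
      (g * a' + h * d' + i * g') (g * b' + h * e' + i * h')
      (g * c' + h * f' + i * i').
Proof.
apply/matrixP => -[[|[|[|//]]] ?] [[|[|[|//]]] ?];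
by rewrite !mxE !big_ord_recl big_ord0 !mxE /= ?addr0 ?addrA.
Qed.

Lemma adjmx3 (a b c d e f g h i : K) :
  adjmx (mx3 a b c d e f g h i) =
  mx3 (star a) (star d) (star g) (star b) (star e) (star h)
      (star c) (star f) (star i).
Proof. by apply/matrixP => -[[|[|[|//]]] ?] [[|[|[|//]]] ?]; rewrite !mxE. Qed.

Lemma mx3_1 : 1%:M = mx3 1 0 0 0 1 0 0 0 (1 : K).
Proof. by apply/matrixP => -[[|[|[|//]]] ?] [[|[|[|//]]] ?]; rewrite !mxE. Qed.

Lemma formJ2 : formJ *m formJ = 1%:M.
Proof. by rewrite mx3M mx3_1; rewrite !(mul0r, mul1r, addr0, add0r). Qed.

Lemma adj_formJ : adjmx formJ = formJ.
Proof. by rewrite adjmx3 !(star0, star1). Qed.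

Lemma isometryJP g :
  reflect (GL3 g /\ adjmx g *m formJ *m g = formJ) (g \in isometryJ).
Proof. exact: asboolP. Qed.

Definition inv_isoJ_mx g := formJ *m adjmx g *m formJ.

Lemma isometryJ_mulV g : g \in isometryJ -> inv_isoJ_mx g *m g = 1%:M.
Proof.
case/isometryJP=> _ gJ.
by rewrite /inv_isoJ_mx -!mulmxA (mulmxA (adjmx g)) gJ formJ2.
Qed.

Lemma isometryJ_mulrV g : g \in isometryJ -> g *m inv_isoJ_mx g = 1%:M.
Proof.
move=> gP; have /isometryJP[[h [hg gh]] _] := gP.
suff -> : inv_isoJ_mx g = h by [].
by rewrite -[LHS]mulmx1 -gh mulmxA isometryJ_mulV // mul1mx.
Qed.

Lemma isometryJ1 : 1%:M \in isometryJ.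
Proof.
apply/isometryJP; split; last by rewrite adjmx1 mul1mx mulmx1.
by exists 1%:M; rewrite mulmx1.
Qed.

Lemma isometryJM g h :
  g \in isometryJ -> h \in isometryJ -> g *m h \in isometryJ.
Proof.
move=> /isometryJP[[g' [g'g gg']] gJ] /isometryJP[[h' [h'h hh']] hJ].
apply/isometryJP; split.
  exists (h' *m g'); split.
    by rewrite -mulmxA (mulmxA g') g'g mul1mx.
  by rewrite -mulmxA (mulmxA h) hh' mul1mx.
by rewrite adjmxM -!mulmxA (mulmxA formJ) (mulmxA (adjmx g)) (mulmxA (adjmx g))
           gJ mulmxA.
Qed.

Lemma isometryJV g : g \in isometryJ -> inv_isoJ_mx g \in isometryJ.
Proof.
move=> gP; apply/isometryJP; split.
  by exists g; rewrite isometryJ_mulV // isometryJ_mulrV.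
rewrite {1}/inv_isoJ_mx !adjmxM adjmxK adj_formJ.
rewrite -!mulmxA (mulmxA formJ formJ) formJ2 mul1mx.
by rewrite isometryJ_mulrV // mulmx1.
Qed.

Definition isoJ_one : isoJ := Sub 1%:M isometryJ1.
Definition isoJ_mul (g h : isoJ) : isoJ :=
  Sub (val g *m val h) (isometryJM (valP g) (valP h)).
Definition isoJ_inv (g : isoJ) : isoJ :=
  Sub (inv_isoJ_mx (val g)) (isometryJV (valP g)).

Lemma isoJ_mulA : associative isoJ_mul.
Proof. by move=> f g h; apply: val_inj; rewrite /= mulmxA. Qed.

Lemma isoJ_mul1 : left_id isoJ_one isoJ_mul.
Proof. by move=> g; apply: val_inj; rewrite /= mul1mx. Qed.

Lemma isoJ_mulr1 : right_id isoJ_one isoJ_mul.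
Proof. by move=> g; apply: val_inj; rewrite /= mulmx1. Qed.

Lemma isoJ_mulV : left_inverse isoJ_one isoJ_inv isoJ_mul.
Proof. by move=> g; apply: val_inj; rewrite /= isometryJ_mulV // (valP g). Qed.

Lemma isoJ_mulrV : right_inverse isoJ_one isoJ_inv isoJ_mul.
Proof. by move=> g; apply: val_inj; rewrite /= isometryJ_mulrV // (valP g). Qed.

HB.instance Definition _ := isGroup.Build isoJ
  isoJ_mulA isoJ_mul1 isoJ_mulr1 isoJ_mulV isoJ_mulrV.

Lemma val_isoJM (g h : isoJ) : val (g * h)%g = val g *m val h.
Proof. by []. Qed.

Lemma val_isoJ1 : val (1%g : isoJ) = 1%:M.
Proof. by []. Qed.

End Isometries.

(* Quat a b c d stands for a + b i + c j + d k. *)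
Record quat (R : Type) := Quat { qre : R; qi : R; qj : R; qk : R }.

Section QuatCoords.
Variable R : Type.

Definition quat_coords (x : quat R) : R * R * R * R :=
  (qre x, qi x, qj x, qk x).

Definition coords_quat (t : R * R * R * R) : quat R :=
  Quat t.1.1.1 t.1.1.2 t.1.2 t.2.

Lemma quat_coordsK : cancel quat_coords coords_quat.
Proof. by case. Qed.

Lemma coords_quatK : cancel coords_quat quat_coords.
Proof. by case=> [[[]]]. Qed.

End QuatCoords.

HB.instance Definition _ (R : eqType) :=
  Equality.copy (quat R) (can_type (@quat_coordsK R)).
HB.instance Definition _ (R : choiceType) :=
  Choice.copy (quat R) (can_type (@quat_coordsK R)).

Section QuatRing.
Variable R : comNzRingType.
Implicit Types x y z : quat R.

Definition addq x y :=
  Quat (qre x + qre y) (qi x + qi y) (qj x + qj y) (qk x + qk y).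
Definition oppq x := Quat (- qre x) (- qi x) (- qj x) (- qk x).
Definition mulq x y :=
  let: Quat a b c d := x in let: Quat a' b' c' d' := y in
  Quat (a * a' - b * b' - c * c' - d * d')
       (a * b' + b * a' + c * d' - d * c')
       (a * c' - b * d' + c * a' + d * b')
       (a * d' + b * c' - c * b' + d * a').
Definition conjq x := Quat (qre x) (- qi x) (- qj x) (- qk x).

Lemma addqA : associative addq.
Proof. by case=> ? ? ? ? [? ? ? ?] [? ? ? ?]; congr Quat; exact: addrA. Qed.
Lemma addqC : commutative addq.
Proof. by case=> ? ? ? ? [? ? ? ?]; congr Quat; exact: addrC. Qed.
Lemma add0q : left_id (Quat 0 0 0 0) addq.
Proof. by case=> ? ? ? ?; congr Quat; exact: add0r. Qed.
Lemma addNq : left_inverse (Quat 0 0 0 0) oppq addq.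
Proof. by case=> ? ? ? ?; congr Quat; exact: addNr. Qed.

HB.instance Definition _ := GRing.isZmodule.Build (quat R)
  addqA addqC add0q addNq.

Lemma mulqA : associative mulq.
Proof. by case=> ? ? ? ? [? ? ? ?] [? ? ? ?]; congr Quat => /=; ring. Qed.
Lemma mul1q : left_id (Quat 1 0 0 0) mulq.
Proof. by case=> ? ? ? ?; congr Quat => /=; ring. Qed.
Lemma mulq1 : right_id (Quat 1 0 0 0) mulq.
Proof. by case=> ? ? ? ?; congr Quat => /=; ring. Qed.
Lemma mulqDl : left_distributive mulq addq.
Proof. by case=> ? ? ? ? [? ? ? ?] [? ? ? ?]; congr Quat => /=; ring. Qed.
Lemma mulqDr : right_distributive mulq addq.
Proof. by case=> ? ? ? ? [? ? ? ?] [? ? ? ?]; congr Quat => /=; ring. Qed.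
Lemma oneq_neq0 : Quat 1 0 0 0 != 0 :> quat R.
Proof. by apply/eqP => -[/eqP]; rewrite oner_eq0. Qed.

HB.instance Definition _ := GRing.Zmodule_isNzRing.Build (quat R)
  mulqA mul1q mulq1 mulqDl mulqDr oneq_neq0.

Lemma conjqD : {morph conjq : x y / x + y}.
Proof. by case=> ? ? ? ? [? ? ? ?]; congr Quat => /=; ring. Qed.
Lemma conjqM x y : conjq (x * y) = conjq y * conjq x.
Proof. by case: x y => ? ? ? ? [? ? ? ?]; congr Quat => /=; ring. Qed.
Lemma conjqK : involutive conjq.
Proof. by case=> ? ? ? ?; congr Quat => /=; ring. Qed.

HB.instance Definition _ := isStarRing.Build (quat R) conjqD conjqM conjqK.

End QuatRing.

HB.instance Definition _ (R : realType) :=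
  Topological.copy (quat R) (initial_topology (@quat_coords R)).

Section Conjc.
Variable R : rcfType.

Fact conjc_starD : {morph @conjc R : x y / x + y}.
Proof. by case=> a b [c d]; congr Complex => /=; ring. Qed.
Fact conjc_starM (x y : R[i]) : conjc (x * y) = conjc y * conjc x.
Proof. by case: x y => a b [c d]; congr Complex => /=; ring. Qed.
Fact conjc_starK : involutive (@conjc R).
Proof. by case=> a b; congr Complex => /=; ring. Qed.

HB.instance Definition _ := isStarRing.Build R[i]
  conjc_starD conjc_starM conjc_starK.
End Conjc.

Definition U21 (R : realType) := isoJ R[i].
Definition Sp21 (R : realType) := isoJ (quat R).

HB.instance Definition _ (R : realType) := Group.on (U21 R).
HB.instance Definition _ (R : realType) := SubChoice.on (U21 R).
HB.instance Definition _ (R : realType) := Group.on (Sp21 R).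
HB.instance Definition _ (R : realType) := SubChoice.on (Sp21 R).
HB.instance Definition _ (R : realType) := Topological.copy (Sp21 R)
  (initial_topology (fun g : Sp21 R => val g : 'M[quat R]_3)).

Section Inclusions.
Variable R : realType.

Definition det_one : {pred U21 R} := fun g => \det (val g) == 1.

Lemma det_one_closed : group_closed det_one.
Proof.
have mem_det g : (g \in det_one) = (\det (val g) == 1) by [].
have detV (g : U21 R) : g \in det_one -> (g^-1)%g \in det_one.
  rewrite !mem_det => /eqP g1.
  apply/eqP; rewrite -[LHS]mul1r -[X in X * _]g1 -det_mulmx -val_isoJM mulgV.
  exact: det1.
split; first by rewrite mem_det val_isoJ1 det1.
move=> g h gP /detV; rewrite !mem_det in gP * => /eqP hP.
by rewrite det_mulmx (eqP gP) hP mulr1.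
Qed.

Definition SU21 := {g : U21 R | g \in det_one}.

HB.instance Definition _ := SubType.on SU21.
HB.instance Definition _ := [Choice of SU21 by <:].
HB.instance Definition _ :=
  SubChoice_isSubGroup.Build _ _ SU21 det_one_closed.

Definition SU21_U21 (g : SU21) : U21 R := val g.

Fact SU21_U21M : {morph SU21_U21 : g h / (g * h)%g >-> (g * h)%g}.
Proof. by []. Qed.
HB.instance Definition _ := isMultiplicative.Build _ _ SU21_U21 SU21_U21M.

Definition quat_of_complex (z : R[i]) : quat R :=
  Quat (complex.Re z) (complex.Im z) 0 0.

Fact quat_of_complexB : {morph quat_of_complex : x y / x - y}.
Proof. by case=> a b [c d]; congr Quat => /=; ring. Qed.
HB.instance Definition _ :=
  GRing.isZmodMorphism.Build R[i] (quat R) quat_of_complex quat_of_complexB.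

Fact quat_of_complexM : monoid_morphism quat_of_complex.
Proof. by split=> // -[a b] [c d]; congr Quat => /=; ring. Qed.
HB.instance Definition _ :=
  GRing.isMonoidMorphism.Build R[i] (quat R) quat_of_complex quat_of_complexM.

Lemma quat_of_complex_star z : quat_of_complex (star z) = star (quat_of_complex z).
Proof. by case: z => a b; congr Quat => /=; rewrite oppr0. Qed.

Definition quat_mx_of_complex (M : 'M[R[i]]_3) : 'M[quat R]_3 :=
  map_mx quat_of_complex M.

Lemma quat_mx_of_complex_isometryJ (M : 'M[R[i]]_3) :
  M \in isometryJ (K := R[i]) -> quat_mx_of_complex M \in isometryJ (K := quat R).
Proof.
have adjE (N : 'M[R[i]]_3) :
    adjmx (quat_mx_of_complex N) = quat_mx_of_complex (adjmx N).
  by apply/matrixP => i j; rewrite !mxE -quat_of_complex_star.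
have JE : formJ (quat R) = quat_mx_of_complex (formJ R[i]).
  by apply/matrixP => -[[|[|[|//]]] ?] [[|[|[|//]]] ?];
    rewrite !mxE /= ?rmorph0 ?rmorph1.
move=> /isometryJP[[N [NM MN]] MJ]; apply/isometryJP; split.
  exists (quat_mx_of_complex N).
  by rewrite -!map_mxM NM MN map_mx1.
by rewrite adjE JE -!map_mxM MJ.
Qed.

Definition U21_Sp21 (g : U21 R) : Sp21 R :=
  Sub (quat_mx_of_complex (val g)) (quat_mx_of_complex_isometryJ (valP g)).

Fact U21_Sp21M : {morph U21_Sp21 : g h / (g * h)%g >-> (g * h)%g}.
Proof. by move=> g h; apply: val_inj; rewrite /= /quat_mx_of_complex map_mxM. Qed.
HB.instance Definition _ := isMultiplicative.Build _ _ U21_Sp21 U21_Sp21M.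

End Inclusions.

(* The generators a and b are false and true; capital letters denote the
   inverses. *)
Definition fig8_relator : word bool :=
  let a := (false, false) in let A := (false, true) in
  let b := (true, false) in let B := (true, true) in
  [:: B; a; b; A; b; a; B; A; b; A].

Definition Gamma8 := pres_group [:: fig8_relator].

HB.instance Definition _ := Group.on Gamma8.

Definition gen_a : Gamma8 := pres_gen _ false.
Definition gen_b : Gamma8 := pres_gen _ true.

Definition Hom8 (R : realType) := {multiplicative Gamma8 -> Sp21 R}.

(* rho |-> (rho a, rho b) is injective, so that the initial topology is the
   subspace topology of the image in Sp(2,1)^2. *)
HB.instance Definition _ (R : realType) := gen_eqMixin (Hom8 R).
HB.instance Definition _ (R : realType) := gen_choiceMixin (Hom8 R).
HB.instance Definition _ (R : realType) := Topological.copy (Hom8 R)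
  (initial_topology (fun rho : Hom8 R => (rho gen_a, rho gen_b))).


Lemma mx3_eq (K : Type) (a b c d e f g h i a' b' c' d' e' f' g' h' i' : K) :
  [/\ a = a', b = b' & c = c'] -> [/\ d = d', e = e' & f = f'] ->
  [/\ g = g', h = h' & i = i'] ->
  mx3 a b c d e f g h i = mx3 a' b' c' d' e' f' g' h' i'.
Proof. by move=> [-> -> ->] [-> -> ->] [-> -> ->]. Qed.

Section Rho0.
Variable R : realType.
Local Open Scope complex_scope.

Definition tau : R[i] := (- 1 - 'i * (Num.sqrt 3)%:C) / 2.

Definition rho0_a_mx : 'M[R[i]]_3 :=
  mx3 1 1 tau
      0 1 (- 1)
      0 0 1.

Definition rho0_b_mx : 'M[R[i]]_3 :=
  mx3 1   0     0
      1   1     0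
      tau (- 1) 1.

Lemma tau_sqr : tau ^+ 2 = - 1 - tau.
Proof.
have s3 : ('i * (Num.sqrt (3 : R))%:C) ^+ 2 = - 3 :> R[i].
  rewrite exprMn sqr_i -rmorphXn /= sqr_sqrtr ?ler0n // mulN1r.
  by rewrite rmorph_nat.
rewrite /tau; move: ('i * _) s3 => s s3.
by field: s3.
Qed.

Lemma star_tau : star tau = - 1 - tau.
Proof.
have -> : tau = (- 2^-1) +i* (- (Num.sqrt 3 / 2)).
  apply: (mulIf (_ : 2 != 0 :> R[i])); first by rewrite pnatr_eq0.
  rewrite divfK ?pnatr_eq0 // -[2 in RHS]/(2%:R) -(rmorph_nat (real_complex R)).
  rewrite /real_complex_def; congr Complex => /=; field; rewrite ?pnatr_eq0 //.
by congr Complex => /=; field.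
Qed.

Lemma rho0_a_isometryJ : rho0_a_mx \in isometryJ (K := R[i]).
Proof.
have t2 := tau_sqr; apply/isometryJP; split.
  exists (mx3 1 (- 1) (- 1 - tau) 0 1 1 0 0 1).
  by split; rewrite mx3M mx3_1; apply: mx3_eq; split; ring.
rewrite adjmx3 !mx3M.
rewrite star_tau !star0 !star1 [star (- 1)](rmorphN1 (@conjc R)).
by apply: mx3_eq; split; ring: t2.
Qed.

Lemma rho0_b_isometryJ : rho0_b_mx \in isometryJ (K := R[i]).
Proof.
have t2 := tau_sqr; apply/isometryJP; split.
  exists (mx3 1 0 0 (- 1) 1 0 (- 1 - tau) 1 1).
  by split; rewrite mx3M mx3_1; apply: mx3_eq; split; ring.
rewrite adjmx3 !mx3M.
rewrite star_tau !star0 !star1 [star (- 1)](rmorphN1 (@conjc R)).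
by apply: mx3_eq; split; ring: t2.
Qed.

Definition rho0_a_U21 : U21 R := Sub rho0_a_mx rho0_a_isometryJ.
Definition rho0_b_U21 : U21 R := Sub rho0_b_mx rho0_b_isometryJ.

Lemma rho0_a_det : rho0_a_U21 \in @det_one R.
Proof.
apply/eqP; rewrite -det_tr det_trig; last first.
  by apply/is_trig_mxP => -[[|[|[|//]]] ?] [[|[|[|//]]] ?] //; rewrite !mxE.
by rewrite !big_ord_recl big_ord0 !mxE /= !mulr1.
Qed.

Lemma rho0_b_det : rho0_b_U21 \in @det_one R.
Proof.
apply/eqP; rewrite det_trig; last first.
  by apply/is_trig_mxP => -[[|[|[|//]]] ?] [[|[|[|//]]] ?] //; rewrite !mxE.
by rewrite !big_ord_recl big_ord0 !mxE /= !mulr1.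
Qed.

Definition rho0_gen (s : bool) : SU21 R :=
  if s then Sub rho0_b_U21 rho0_b_det else Sub rho0_a_U21 rho0_a_det.

Lemma rho0_rels : {in [:: fig8_relator], forall r, eval_word rho0_gen r = 1%g}.
Proof.
have t2 := tau_sqr.
move=> r; rewrite inE => /eqP ->; rewrite /eval_word !big_cons big_nil /=.
set a := Sub rho0_a_U21 _; set b := Sub rho0_b_U21 _.
suff e : (b^-1 * a * b * a^-1 * b = a * (b^-1 * a * b * a^-1))%g.
  by rewrite mulg1 !mulgA e !mulgA mulgVK mulgK mulgK mulgVK mulgV.
have mulE (g h : SU21 R) : val (val (g * h)%g) = val (val g) *m val (val h) by [].
have aV : val (val a^-1%g) = mx3 1 (- 1) (- 1 - tau) 0 1 1 0 0 1.
  rewrite -[LHS]/(inv_isoJ_mx rho0_a_mx) /inv_isoJ_mx adjmx3 !mx3M.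
  rewrite star_tau !star0 !star1 [star (- 1)](rmorphN1 (@conjc R)).
  by apply: mx3_eq; split; ring.
have bV : val (val b^-1%g) = mx3 1 0 0 (- 1) 1 0 (- 1 - tau) 1 1.
  rewrite -[LHS]/(inv_isoJ_mx rho0_b_mx) /inv_isoJ_mx adjmx3 !mx3M.
  rewrite star_tau !star0 !star1 [star (- 1)](rmorphN1 (@conjc R)).
  by apply: mx3_eq; split; ring.
apply/val_inj/val_inj; rewrite !mulE aV bV !SubK !mx3M.
by apply: mx3_eq; split; ring: t2.
Qed.

Definition rho0 (x : Gamma8) : SU21 R := pres_lift rho0_gen x.

Fact rho0M : {morph rho0 : x y / (x * y)%g >-> (x * y)%g}.
Proof. exact: pres_liftM rho0_rels. Qed.
HB.instance Definition _ := isMultiplicative.Build Gamma8 (SU21 R) rho0 rho0M.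

Lemma rho0_aE : val (val (rho0 gen_a)) = rho0_a_mx.
Proof. by rewrite /rho0 /gen_a (pres_lift_gen rho0_rels). Qed.

Lemma rho0_bE : val (val (rho0 gen_b)) = rho0_b_mx.
Proof. by rewrite /rho0 /gen_b (pres_lift_gen rho0_rels). Qed.

Definition rho0_Sp21 : Hom8 R := @U21_Sp21 R \o @SU21_U21 R \o rho0.

End Rho0.

(* Main.v *)
Require Import Defs.
From HB Require Import structures.
From mathcomp Require Import all_boot all_order all_algebra.
From mathcomp Require Import complex ring lra.
From mathcomp Require Import all_classical all_reals all_analysis.

Set Implicit Arguments.
Unset Strict Implicit.
Unset Printing Implicit Defensive.

Import Order.TTheory GRing.Theory Num.Theory.
Import numFieldNormedType.Exports.

Local Open Scope ring_scope.
Local Open Scope classical_set_scope.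

(** Write a quaternionic matrix as P + Q j with P and Q complex; Q j is its
    j-part.  An element of Sp(2,1) lies in U(2,1) exactly when its j-part
    vanishes, so a representation has to be conjugated until the j-parts of the
    images of both generators are zero.

    As a U(2,1)-module the Lie algebra of Sp(2,1) is the sum of that of U(2,1)
    and of V = { S j : S complex and symmetric about the antidiagonal }, the
    second symmetric power of C^3.  The reason for the theorem is that
    H^1(Gamma8, V) = 0 at rho0.  Since the group has two generators and one
    relator, a cocycle is a pair in V^2 killed by the linearised relator [fox],
    and the vanishing is a computation over Q(tau): adding a coboundary kills
    six of the twelve complex coordinates of any pair ([coboundary_slice]), and
    [fox] is injective on the pairs for which these six coordinates are zero
    ([fox_injective]).

    The passage from this linear statement to small deformations is Newton's
    method.  Let a representation be at distance at most eta from rho0 and let f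
    be the total size of its two j-parts.  Up to errors O(eta f) these j-parts
    form a pair in V^2, and conjugation by an isometry 1 + xi + O(f^2), with xi
    in V of size O(f), adds the coboundary of xi to it.  If xi is taken from
    [coboundary_slice], the new j-parts are killed by [fox] up to O(eta f),
    hence they are O(eta f) themselves ([improvement]).

    Instead of iterating this step one minimises, over a compact set of
    isometries g, the size of the j-parts after conjugation by g plus a small
    multiple of the distance from g to 1 ([straighten]).  The second term keeps
    the minimiser close to 1, and if some j-part survived there, then one more
    step would lower the sum, because it gains more in the first term than it
    loses in the second. *)

(** * Norms and j-parts of quaternionic matrices *)
Section QuatNorm.
Variable R : realType.
Implicit Types x y : quat R.

(** The l1-norm is submultiplicative and, unlike the Euclidean norm, its
    inequalities are linear in the absolute values of the coordinates. *)
Definition qnorm x : R := `|qre x| + `|qi x| + `|qj x| + `|qk x|.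

Lemma qnorm_ge0 x : 0 <= qnorm x.
Proof. by rewrite /qnorm !addr_ge0. Qed.

Lemma qnorm0 : qnorm 0 = 0.
Proof. by rewrite /qnorm /= normr0 !addr0. Qed.

Lemma qnorm1 : qnorm 1 = 1.
Proof. by rewrite /qnorm /= normr0 normr1 !addr0. Qed.

Lemma qnorm0_eq0 x : qnorm x = 0 -> x = 0.
Proof.
case: x => a b c d; rewrite /qnorm /= => /eqP.
rewrite !paddr_eq0 ?addr_ge0 // !normr_eq0.
by case/andP=> /andP[/andP[/eqP-> /eqP->] /eqP->] /eqP->.
Qed.

Lemma qnormD x y : qnorm (x + y) <= qnorm x + qnorm y.
Proof.
case: x y => a b c d [a' b' c' d']; rewrite /qnorm /=.
have := ler_normD a a'; have := ler_normD b b'.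
have := ler_normD c c'; have := ler_normD d d'; lra.
Qed.

Lemma qnormN x : qnorm (- x) = qnorm x.
Proof. by case: x => a b c d; rewrite /qnorm /= !normrN. Qed.

Lemma qnorm_star x : qnorm (star x) = qnorm x.
Proof. by case: x => a b c d; rewrite /qnorm /= !normrN. Qed.

Lemma qnormM x y : qnorm (x * y) <= qnorm x * qnorm y.
Proof.
have N4 (p q r s : R) : `|p + q + r + s| <= `|p| + `|q| + `|r| + `|s|.
  have := ler_normD (p + q + r) s; have := ler_normD (p + q) r.
  by have := ler_normD p q; lra.
case: x y => a b c d [a' b' c' d']; rewrite /qnorm /=.
have := N4 (a * a') (- (b * b')) (- (c * c')) (- (d * d')).
have := N4 (a * b') (b * a') (c * d') (- (d * c')).
have := N4 (a * c') (- (b * d')) (c * a') (d * b').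
have := N4 (a * d') (b * c') (- (c * b')) (d * a').
by rewrite !normrN !normrM; lra.
Qed.

Definition cpart x : quat R := Quat (qre x) (qi x) 0 0.
Definition jpart x : quat R := Quat 0 0 (qj x) (qk x).

Lemma cpartD_jpart x : cpart x + jpart x = x.
Proof. by case: x => a b c d; congr Quat; rewrite /= ?addr0 ?add0r. Qed.

Lemma jpartB x y : jpart (x - y) = jpart x - jpart y.
Proof. by case: x y => ? ? ? ? [? ? ? ?]; congr Quat; rewrite /= ?subr0. Qed.

Lemma cpartB x y : cpart (x - y) = cpart x - cpart y.
Proof. by case: x y => ? ? ? ? [? ? ? ?]; congr Quat; rewrite /= ?subr0. Qed.

(** H = C + C j is a Z/2-grading of the quaternions; this is the odd part of a
    product. *)
Lemma jpartM x y : jpart (x * y) = cpart x * jpart y + jpart x * cpart y.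
Proof. by case: x y => ? ? ? ? [? ? ? ?]; congr Quat => /=; ring. Qed.

Lemma jpart_star x : jpart (star x) = star (jpart x).
Proof. by case: x => ? ? ? ?; congr Quat => /=; rewrite oppr0. Qed.

Lemma qnorm_cpart x : qnorm (cpart x) <= qnorm x.
Proof. by rewrite /qnorm /= normr0 !addr0 -addrA lerDl addr_ge0. Qed.

Lemma qnorm_jpart x : qnorm (jpart x) <= qnorm x.
Proof. by rewrite /qnorm /= normr0 !add0r -addrA lerDr addr_ge0. Qed.

End QuatNorm.

Section MatrixNorm.
Variable R : realType.
Local Notation M3 := 'M[quat R]_3.
Implicit Types X Y : M3.

Definition mnorm X : R := \sum_i \sum_j qnorm (X i j).

Lemma mnorm_ge0 X : 0 <= mnorm X.
Proof. by do 2!apply: sumr_ge0 => ? _; exact: qnorm_ge0. Qed.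

Lemma qnorm_le_mnorm X i j : qnorm (X i j) <= mnorm X.
Proof.
rewrite /mnorm (bigD1 i) //= (bigD1 j) //= -addrA lerDl addr_ge0 //.
  by apply: sumr_ge0 => ? _; exact: qnorm_ge0.
by do 2!apply: sumr_ge0 => ? _; exact: qnorm_ge0.
Qed.

Lemma mnorm0_eq0 X : mnorm X = 0 -> X = 0.
Proof.
move=> X0; apply/matrixP => i j; rewrite mxE; apply: qnorm0_eq0.
by apply/eqP; rewrite eq_le qnorm_ge0 -X0 qnorm_le_mnorm.
Qed.

Lemma mnorm0 : mnorm 0 = 0.
Proof.
rewrite /mnorm big1 // => i _; rewrite big1 // => j _.
by rewrite mxE qnorm0.
Qed.

Lemma mnormD X Y : mnorm (X + Y) <= mnorm X + mnorm Y.
Proof.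
rewrite /mnorm -big_split /=; apply: ler_sum => i _.
rewrite -big_split /=; apply: ler_sum => j _; rewrite mxE; exact: qnormD.
Qed.

Lemma mnormN X : mnorm (- X) = mnorm X.
Proof. by do 2!apply: eq_bigr => ? _; rewrite mxE qnormN. Qed.

Lemma mnormB X Y : mnorm (X - Y) <= mnorm X + mnorm Y.
Proof. by rewrite -(mnormN Y) mnormD. Qed.

Lemma mnormBC X Y : mnorm (X - Y) = mnorm (Y - X).
Proof. by rewrite -mnormN opprB. Qed.

Lemma mnormM X Y : mnorm (X * Y) <= mnorm X * mnorm Y.
Proof.
have qsum (F : 'I_3 -> quat R) : qnorm (\sum_k F k) <= \sum_k qnorm (F k).
  elim/big_ind2: _ => [|a b c d ab cd|//]; first by rewrite qnorm0.
  by rewrite (le_trans (qnormD _ _)) // lerD.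
rewrite /mnorm mulr_suml; apply: ler_sum => i _.
apply: (@le_trans _ _ (\sum_k \sum_j qnorm (X i k) * qnorm (Y k j))).
  rewrite exchange_big; apply: ler_sum => j _; rewrite mxE.
  apply: le_trans (qsum _) _; apply: ler_sum => k _; exact: qnormM.
rewrite mulr_suml; apply: ler_sum => k _; rewrite -mulr_sumr.
rewrite ler_wpM2l ?qnorm_ge0 // [leRHS](bigD1 k) //= lerDl.
by do 2!apply: sumr_ge0 => ? _; exact: qnorm_ge0.
Qed.

Lemma mnorm_mx3 (a b c d e f g h i : quat R) :
  mnorm (mx3 a b c d e f g h i) =
  qnorm a + qnorm b + qnorm c + qnorm d + qnorm e + qnorm f +
  qnorm g + qnorm h + qnorm i.
Proof.
rewrite /mnorm !big_ord_recl !big_ord0 !mxE /= !addr0; ring.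
Qed.

Lemma mnorm1 : mnorm 1 = 3.
Proof.
by rewrite -[1]/(1%:M) mx3_1 mnorm_mx3 qnorm0 qnorm1; ring.
Qed.

Definition cpart_mx X : M3 := map_mx (@cpart R) X.
Definition jpart_mx X : M3 := map_mx (@jpart R) X.

Lemma cpartD_jpart_mx X : cpart_mx X + jpart_mx X = X.
Proof. by apply/matrixP => i j; rewrite !mxE cpartD_jpart. Qed.

Lemma jpart_mxB X Y : jpart_mx (X - Y) = jpart_mx X - jpart_mx Y.
Proof. by apply/matrixP => i j; rewrite !mxE jpartB. Qed.

Lemma cpart_mxB X Y : cpart_mx (X - Y) = cpart_mx X - cpart_mx Y.
Proof. by apply/matrixP => i j; rewrite !mxE cpartB. Qed.

Lemma jpart_mxM X Y :
  jpart_mx (X * Y) = cpart_mx X * jpart_mx Y + jpart_mx X * cpart_mx Y.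
Proof.
apply/matrixP => i j; rewrite !mxE -big_split /=.
have jD : {morph @jpart R : x y / x + y}.
  by move=> [? ? ? ?] [? ? ? ?]; congr Quat; rewrite /= ?addr0.
rewrite (big_morph _ jD (erefl : jpart 0 = 0)); apply: eq_bigr => k _.
by rewrite jpartM !mxE.
Qed.

Lemma mnorm_cpart X : mnorm (cpart_mx X) <= mnorm X.
Proof. by do 2!apply: ler_sum => ? _; rewrite mxE qnorm_cpart. Qed.

Lemma mnorm_jpart X : mnorm (jpart_mx X) <= mnorm X.
Proof. by do 2!apply: ler_sum => ? _; rewrite mxE qnorm_jpart. Qed.

End MatrixNorm.

(** * The adjoint for the form J *)
Section Dagger.
Variable R : realType.
Local Notation M3 := 'M[quat R]_3.
Implicit Types X Y : M3.

(** [J X^* J], the adjoint of [X] with respect to the Hermitian form [J]: an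
    isometry is a matrix whose inverse is its adjoint.  Conjugation by [J]
    reverses the order of rows and columns. *)
Definition dag X : M3 := \matrix_(i, j) star (X (rev_ord j) (rev_ord i)).

Lemma inv_isoJ_mxE X : inv_isoJ_mx X = dag X.
Proof.
have JE k l : formJ (quat R) k l = (l == rev_ord k)%:R.
  by case: k l => [[|[|[|//]]] ?] [[|[|[|//]]] ?]; rewrite mxE.
apply/matrixP => i j; rewrite /inv_isoJ_mx !mxE.
rewrite (bigD1 (rev_ord j)) //= big1 => [|k kj]; last first.
  by rewrite JE -(can2_eq rev_ordK rev_ordK) eq_sym (negPf kj) mulr0.
rewrite JE rev_ordK eqxx mulr1 addr0 mxE (bigD1 (rev_ord i)) //=.
rewrite big1 => [|k ki].
  by rewrite JE eqxx mul1r addr0 !mxE.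
by rewrite JE (negPf ki) mul0r.
Qed.

Lemma dagK : involutive dag.
Proof. by move=> X; apply/matrixP => i j; rewrite !mxE !rev_ordK starK. Qed.

Lemma dagM X Y : dag (X * Y) = dag Y * dag X.
Proof.
rewrite -!inv_isoJ_mxE -!mulmxE /inv_isoJ_mx adjmxM -!mulmxA.
congr (_ *m (_ *m _)).
by rewrite (mulmxA (formJ _) (formJ _)) formJ2 mul1mx.
Qed.

Lemma dagD X Y : dag (X + Y) = dag X + dag Y.
Proof. by apply/matrixP => i j; rewrite !mxE starD. Qed.

Lemma dag0 : dag 0 = 0.
Proof. by apply/matrixP => i j; rewrite !mxE star0. Qed.

Lemma dagN X : dag (- X) = - dag X.
Proof. by apply/eqP; rewrite -addr_eq0 -dagD addNr dag0. Qed.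

Lemma dagB X Y : dag (X - Y) = dag X - dag Y.
Proof. by rewrite dagD dagN. Qed.

Lemma dag1 : dag 1 = 1.
Proof. by rewrite -inv_isoJ_mxE /inv_isoJ_mx adjmx1 mulmx1 formJ2. Qed.

Lemma dag_mx3 (a b c d e f g h i : quat R) :
  dag (mx3 a b c d e f g h i) =
  mx3 (star i) (star f) (star c) (star h) (star e) (star b)
      (star g) (star d) (star a).
Proof.
by apply/matrixP => -[[|[|[|//]]] ?] [[|[|[|//]]] ?]; rewrite !mxE.
Qed.

Lemma mnorm_dag X : mnorm (dag X) = mnorm X.
Proof.
rewrite /mnorm exchange_big /= (reindex_inj rev_ord_inj) /=.
apply: eq_bigr => i _; rewrite (reindex_inj rev_ord_inj) /=.
by apply: eq_bigr => j _; rewrite mxE !rev_ordK qnorm_star.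
Qed.

Lemma jpart_dag X : jpart_mx (dag X) = dag (jpart_mx X).
Proof. by apply/matrixP => i j; rewrite !mxE jpart_star. Qed.

End Dagger.

(** * First-order approximations and the linearised relator *)
Section Words.
Variables (T : Type) (mul : T -> T -> T) (inv : T -> T).

(** The relation of the group reads [word_l a b = word_r a b].  The operations
    are parameters, because these words are evaluated both at matrices and at
    dual numbers over matrices, which differentiates them. *)
Definition word_w (a b : T) := mul (mul (mul (inv b) a) b) (inv a).
Definition word_l (a b : T) := mul (word_w a b) b.
Definition word_r (a b : T) := mul a (word_w a b).

End Words.

Section FirstOrder.
Variable R : realType.
Local Notation M3 := 'M[quat R]_3.
Implicit Types (X Y Z : M3) (p q : M3 * M3) (eta f k l : R).

(** The pair [p] stands for [p.1 + e p.2] with [e ^ 2 = 0]. *)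
Definition dual_mul p q := (p.1 * q.1, p.1 * q.2 + p.2 * q.1).
Definition dual_dag p := (dag p.1, dag p.2).

(** [p.1] is a complex matrix near [X] and [p.2] is the j-part of [X] at the
    first order.  There are two scales: [eta] measures the distance to the
    complex matrix, [f <= eta] the j-part, which may be far smaller.  The error
    on the j-part is of order [eta * f] and not just [eta ^ 2]: since complex
    matrices are closed under multiplication, every term of the j-part of a word
    contains a j-part of one of its letters. *)
Definition first_order eta f k X p :=
  [/\ mnorm (X - p.1) <= k * eta, mnorm (jpart_mx X - p.2) <= k * eta * f,
      mnorm p.2 <= k * f, mnorm p.1 <= k & jpart_mx p.1 = 0].

Lemma mnormM_le X Y k l :
  mnorm X <= k -> mnorm Y <= l -> mnorm (X * Y) <= k * l.
Proof.
by move=> Xk Yl; rewrite (le_trans (mnormM _ _)) ?ler_pM ?mnorm_ge0.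
Qed.

Variables (eta f : R).
Hypotheses (f_ge0 : 0 <= f) (f_eta : f <= eta) (eta_le1 : eta <= 1).

Lemma first_order_ge0 k X p : first_order eta f k X p -> 0 <= k.
Proof. by case=> _ _ _ + _; apply: le_trans; exact: mnorm_ge0. Qed.

Lemma first_order_le k l X p : k <= l ->
  first_order eta f k X p -> first_order eta f l X p.
Proof.
have eta_ge0 := le_trans f_ge0 f_eta.
move=> kl [X1 X2 p2 p1 p0]; split=> //; [apply: le_trans X1 _|
  apply: le_trans X2 _|apply: le_trans p2 _|exact: le_trans p1 kl];
  by rewrite ?ler_wpM2r.
Qed.

(** The grading leaves two products in the j-part of [X * Y], each with exactly
    one factor of size [f]; replacing the other factor costs [eta]. *)
Lemma first_orderM k l X Y p q :
  first_order eta f k X p -> first_order eta f l Y q ->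
  first_order eta f (6 * k * l) (X * Y) (dual_mul p q).
Proof.
have eta_ge0 := le_trans f_ge0 f_eta.
move=> aX aY.
have k_ge0 := first_order_ge0 aX; have l_ge0 := first_order_ge0 aY.
case: aX aY => [X0 X1 p2 p1 p0] [Y0 Y1 q2 q1 q0].
have kl_ge0 : 0 <= k * l by exact: mulr_ge0.
have le_eta x : 0 <= x -> x * eta <= x by move=> x0; rewrite ler_piMr.
have nY : mnorm Y <= 2 * l.
  rewrite -[Y](subrK q.1) (le_trans (mnormD _ _)) //.
  by have := le_eta _ l_ge0; move: Y0 q1; clear; lra.
have njY : mnorm (jpart_mx Y) <= 2 * l * f.
  rewrite -[jpart_mx Y](subrK q.2) (le_trans (mnormD _ _)) //.
  have /le_eta : 0 <= l * f by exact: mulr_ge0.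
  by move: Y1 q2; clear; lra.
have cE Z : jpart_mx Z = 0 -> cpart_mx Z = Z.
  by move=> Z0; rewrite -[RHS]cpartD_jpart_mx Z0 addr0.
have cB Z Z0 : jpart_mx Z0 = 0 -> mnorm (cpart_mx Z - Z0) <= mnorm (Z - Z0).
  by move=> /cE {1}<-; rewrite -cpart_mxB mnorm_cpart.
split=> /=.
- have -> : X * Y - p.1 * q.1 = (X - p.1) * Y + p.1 * (Y - q.1).
    by rewrite mulrBl mulrBr subrKA.
  apply: le_trans (mnormD _ _) _.
  have := mnormM_le X0 nY; have := mnormM_le p1 Y0.
  have : 0 <= k * l * eta by exact: mulr_ge0.
  by clear; lra.
- have -> : jpart_mx (X * Y) - (p.1 * q.2 + p.2 * q.1) =
    ((cpart_mx X - p.1) * jpart_mx Y + p.1 * (jpart_mx Y - q.2)) +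
    ((jpart_mx X - p.2) * cpart_mx Y + p.2 * (cpart_mx Y - q.1)).
    by rewrite jpart_mxM !mulrBl !mulrBr !subrKA opprD addrACA.
  apply: le_trans (mnormD _ _) _.
  have := mnormM_le (le_trans (cB X _ p0) X0) njY.
  have := mnormM_le p1 Y1.
  have := mnormM_le X1 (le_trans (mnorm_cpart _) nY).
  have := mnormM_le p2 (le_trans (cB Y _ q0) Y0).
  move=> b4 b3 b2 b1; apply: le_trans (lerD (mnormD _ _) (mnormD _ _)) _.
  apply: le_trans (lerD (lerD b1 b2) (lerD b3 b4)) _.
  by rewrite le_eqVlt; apply/orP; left; apply/eqP; ring.
- apply: le_trans (mnormD _ _) _.
  have := mnormM_le p1 q2; have := mnormM_le p2 q1.
  have : 0 <= k * l * f by exact: mulr_ge0.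
  by clear; lra.
- by have := mnormM_le p1 q1; move: kl_ge0; clear; lra.
- by rewrite jpart_mxM p0 q0 mulr0 mul0r addr0.
Qed.

Lemma first_order_dag k X p :
  first_order eta f k X p -> first_order eta f k (dag X) (dual_dag p).
Proof.
move=> [X0 X1 p2 p1 p0]; split=> /=.
- by rewrite -dagB mnorm_dag.
- by rewrite jpart_dag -dagB mnorm_dag.
- by rewrite mnorm_dag.
- by rewrite mnorm_dag.
- by rewrite jpart_dag p0 dag0.
Qed.

Lemma first_order_tangent_eq k l X Y p q :
  first_order eta f k X p -> first_order eta f l Y q ->
  jpart_mx X = jpart_mx Y ->
  mnorm (p.2 - q.2) <= (k + l) * eta * f.
Proof.
move=> [_ X1 _ _ _] [_ Y1 _ _ _] XY.
rewrite -(subrKA (jpart_mx X)) {2}XY (le_trans (mnormD _ _)) //.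
by rewrite mnormBC; lra.
Qed.


Lemma first_order_word k X Y p q :
  first_order eta f k X p -> first_order eta f k Y q ->
  first_order eta f (6 * (6 * (6 * k * k) * k) * k) (word_w *%R (@dag R) X Y)
    (word_w dual_mul dual_dag p q).
Proof.
move=> aX aY; have aX' := first_order_dag aX; have aY' := first_order_dag aY.
exact: first_orderM (first_orderM (first_orderM aY' aX) aY) aX'.
Qed.

(** The derivative of [word_l - word_r] at [(p.1, q.1)] in the direction
    [(p.2, q.2)]: up to a translation, the Fox derivative of the relator. *)
Definition fox p q :=
  (word_l dual_mul dual_dag p q).2 - (word_r dual_mul dual_dag p q).2.

Lemma first_order_fox k X Y p q :
  first_order eta f k X p -> first_order eta f k Y q ->
  word_l *%R (@dag R) X Y = word_r *%R (@dag R) X Y ->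
  mnorm (fox p q) <= 2 * (6 * (6 * (6 * (6 * k * k) * k) * k) * k) * eta * f.
Proof.
move=> aX aY rel; have aW := first_order_word aX aY.
have := first_order_tangent_eq (first_orderM aW aY) (first_orderM aX aW)
  (congr1 _ rel).
by move/le_trans; apply; lra.
Qed.

End FirstOrder.

(** * Complex coordinates and the explicit linearised relator *)
Section Complexification.
Variable R : realType.
Local Notation C := R[i].
Local Notation M3 := 'M[quat R]_3.
Local Notation Cq := (@quat_of_complex R).
Local Notation Cm := (@quat_mx_of_complex R).
Implicit Types (z w : C) (P Q : 'M[C]_3).

(** The quaternion [z j]. *)
Definition jq z : quat R := Quat 0 0 (complex.Re z) (complex.Im z).

Lemma jqD : {morph jq : z w / z + w}.
Proof. by case=> a b [c d]; congr Quat; rewrite /= addr0. Qed.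

Lemma jqN : {morph jq : z / - z}.
Proof. by case=> a b; congr Quat; rewrite /= oppr0. Qed.

Lemma jq0 : jq 0 = 0. Proof. by []. Qed.

Lemma Cq_jq z w : Cq z * jq w = jq (z * w).
Proof. by case: z w => a b [c d]; congr Quat => /=; ring. Qed.

(** [j w = conj(w) j]. *)
Lemma jq_Cq z w : jq z * Cq w = jq (z * conjc w).
Proof. by case: z w => a b [c d]; congr Quat => /=; ring. Qed.

Lemma jq_star z : star (jq z) = jq (- z).
Proof. by case: z => a b; congr Quat; rewrite /= oppr0. Qed.

Lemma jpart_jq z : jpart (jq z) = jq z.
Proof. by []. Qed.

Definition Jm P : M3 := map_mx jq P.

Lemma CmM P Q : Cm (P *m Q) = Cm P * Cm Q.
Proof. by rewrite /quat_mx_of_complex map_mxM. Qed.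

Lemma CmJm P Q : Cm P * Jm Q = Jm (P *m Q).
Proof.
apply/matrixP => i j; rewrite !mxE (big_morph _ jqD jq0).
by apply: eq_bigr => k _; rewrite !mxE Cq_jq.
Qed.

Lemma JmCm P Q : Jm P * Cm Q = Jm (P *m map_mx conjc Q).
Proof.
apply/matrixP => i j; rewrite !mxE (big_morph _ jqD jq0).
by apply: eq_bigr => k _; rewrite !mxE jq_Cq.
Qed.

Lemma JmD P Q : Jm (P + Q) = Jm P + Jm Q.
Proof. by apply/matrixP => i j; rewrite !mxE jqD. Qed.

Lemma JmN P : Jm (- P) = - Jm P.
Proof. by apply/matrixP => i j; rewrite !mxE jqN. Qed.

Lemma jpart_Cm P : jpart_mx (Cm P) = 0.
Proof. by apply/matrixP => i j; rewrite !mxE. Qed.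

Lemma map_mx3 (K L : Type) (F : K -> L) a b c d e f g h i :
  map_mx F (mx3 a b c d e f g h i) =
  mx3 (F a) (F b) (F c) (F d) (F e) (F f) (F g) (F h) (F i).
Proof. by apply/matrixP => -[[|[|[|//]]] ?] [[|[|[|//]]] ?]; rewrite !mxE. Qed.

Lemma mx3D (K : nmodType) (a b c d e f g h i a' b' c' d' e' f' g' h' i' : K) :
  mx3 a b c d e f g h i + mx3 a' b' c' d' e' f' g' h' i' =
  mx3 (a + a') (b + b') (c + c') (d + d') (e + e') (f + f')
      (g + g') (h + h') (i + i').
Proof. by apply/matrixP => -[[|[|[|//]]] ?] [[|[|[|//]]] ?]; rewrite !mxE. Qed.

Lemma mx3N (K : zmodType) (a b c d e f g h i : K) :
  - mx3 a b c d e f g h i =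
  mx3 (- a) (- b) (- c) (- d) (- e) (- f) (- g) (- h) (- i).
Proof. by apply/matrixP => -[[|[|[|//]]] ?] [[|[|[|//]]] ?]; rewrite !mxE. Qed.

(* dual numbers over complex matrices *)
Lemma dual_mulE P Q P' Q' :
  dual_mul (Cm P, Jm Q) (Cm P', Jm Q') =
  (Cm (P *m P'), Jm (P *m Q' + Q *m map_mx conjc P')).
Proof. by rewrite /dual_mul /= CmM CmJm JmCm -JmD. Qed.

Lemma dual_dagE (a b c d e f g h i a' b' c' d' e' f' g' h' i' : C) :
  dual_dag (Cm (mx3 a b c d e f g h i), Jm (mx3 a' b' c' d' e' f' g' h' i')) =
  (Cm (mx3 (conjc i) (conjc f) (conjc c) (conjc h) (conjc e) (conjc b)
           (conjc g) (conjc d) (conjc a)),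
   Jm (mx3 (- i') (- f') (- c') (- h') (- e') (- b') (- g') (- d') (- a'))).
Proof.
rewrite /dual_dag /quat_mx_of_complex /Jm /= !map_mx3 !dag_mx3.
by rewrite !jq_star -!quat_of_complex_star.
Qed.

(** [Jm S] is skew for [dag], hence tangent to Sp(2,1), exactly when [S] is
    symmetric about the antidiagonal. *)
Definition persym (x1 x2 x3 x4 x5 x6 : C) := mx3 x1 x2 x3 x4 x5 x2 x6 x4 x1.

Definition quatA : M3 := Cm (rho0_a_mx R).
Definition quatB : M3 := Cm (rho0_b_mx R).

Local Notation t := (tau R).

Lemma conjc_tau : conjc t = - 1 - t.
Proof. exact: star_tau. Qed.

Lemma conjc_A : map_mx conjc (rho0_a_mx R) = mx3 1 1 (- 1 - t) 0 1 (- 1) 0 0 1.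
Proof. by rewrite map_mx3 conjc_tau !rmorphN1 !rmorph1 !rmorph0. Qed.

Lemma conjc_B : map_mx conjc (rho0_b_mx R) = mx3 1 0 0 1 1 0 (- 1 - t) (- 1) 1.
Proof. by rewrite map_mx3 conjc_tau !rmorphN1 !rmorph1 !rmorph0. Qed.

(** The linearised relator at [rho0] in the six directions that remain once
    coboundaries are divided out; see [coboundary_slice]. *)
Definition fox_mx (x1 x2 x5 x6 y1 y3 : C) : 'M[C]_3 := mx3
  ((- 2 - 2 * t) * x1 + 2 * t * x2 + (- 1 - 2 * t) * x5 + (1 - t) * x6
   - 2 * t * y1 + (- 2 - t) * y3)
  (2 * x2 + t * x5 + (- 1 + t) * y3)
  (- 2 * t * x1 + x5 + (1 + t) * x6 + (1 - t) * y3)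
  ((- 2 - 2 * t) * x1 + (- 4 - 2 * t) * x2 + 2 * x5 + (2 + t) * x6
   + (2 + 2 * t) * y1)
  (2 * t * x1 + 4 * t * x2 - t * x5 + (2 + 2 * t) * y1)
  (2 * x1 + 2 * x2 + t * x5 + t * x6)
  ((- 2 - 2 * t) * x1 - 2 * x2 + (1 - t) * x5 + (- 2 - t) * x6 + t * y3)
  (- 2 * x1 - 2 * x2 - t * x5 + (1 + t) * y3)
  (- t * x6 + (- 1 - t) * y3).

(** The words are multiplied out letter by letter as dual numbers over complex
    matrices; multiplying by j on the left conjugates the entries, and [tau]
    satisfies [tau ^ 2 = - 1 - tau]. *)
Lemma fox_explicit (x1 x2 x5 x6 y1 y3 : C) :
  fox (quatA, Jm (persym x1 x2 0 0 x5 x6) * quatA)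
      (quatB, Jm (persym y1 0 y3 0 0 0) * quatB) =
  Jm (fox_mx x1 x2 x5 x6 y1 y3).
Proof.
have t2 := tau_sqr R.
(* The two matrices and their adjoints, then the partial products of
   [word_l] and [word_r]. *)
pose a := (Cm (mx3 1 1 t 0 1 (- 1) 0 0 1),
   Jm (mx3
    x1 (x1 + x2) ((- 1 - t) * x1 - x2)
    0 x5 (x2 - x5)
    x6 x6 (x1 + (- 1 - t) * x6))).
pose b := (Cm (mx3 1 0 0 1 1 0 t (- 1) 1),
   Jm (mx3
    (y1 + (- 1 - t) * y3) (- y3) y3
    0 0 0
    ((- 1 - t) * y1) (- y1) y1)).
pose a' := (Cm (mx3 1 (- 1) (- 1 - t) 0 1 1 0 0 1),
   Jm (mx3
    (- x1 + (1 + t) * x6) (- x2 + x5) ((1 + t) * x1 + x2)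
    (- x6) (- x5) (- x1 - x2)
    (- x6) 0 (- x1))).
pose b' := (Cm (mx3 1 0 0 (- 1) 1 0 (- 1 - t) 1 1),
   Jm (mx3
    (- y1) 0 (- y3)
    y1 0 y3
    ((1 + t) * y1) 0 (- y1 + (1 + t) * y3))).
pose w1 := (Cm (mx3 1 1 t (- 1) 0 (- 1 - t) (- 1 - t) (- t) 1),
   Jm (mx3
    (x1 - y1) (x1 + x2 - y1) ((- 1 - t) * x1 - x2 + (1 + t) * y1 - y3)
    (- x1 + y1)
    (- x1 - x2 + x5 + y1)
    ((1 + t) * x1 + 2 * x2 - x5 + (- 1 - t) * y1 + y3)
    ((- 1 - t) * x1 + x6 + (1 + t) * y1)
    ((- 1 - t) * x1 + (- 1 - t) * x2 + x5 + x6 + (1 + t) * y1)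
    ((1 + t) * x1 + (2 + t) * x2 - x5 + (- 1 - t) * x6 + (- 1 - t) * y1
     + (1 + t) * y3))).
pose w2 := (Cm (mx3 (1 - t) (1 - t) t 0 (1 + t) (- 1 - t)
                    (- 1 - t) (- 1 - t) 1),
   Jm (mx3
    ((2 + t) * x1 + (2 + t) * x2 - t * y1)
    ((2 + t) * x1 + 2 * x2 + (- 2 - 2 * t) * y1)
    ((- 1 - t) * x1 - x2 + (1 + 2 * t) * y1)
    ((- 2 - t) * x1 + (- 3 - 2 * t) * x2 + (2 + t) * x5 + (1 + 2 * t) * y1)
    ((- 2 - t) * x1 - 3 * x2 + 2 * x5 + (3 + 2 * t) * y1)
    ((1 + t) * x1 + 2 * x2 - x5 + (- 2 - 2 * t) * y1)
    ((- 2 - 3 * t) * x1 + (- 2 - 3 * t) * x2 + (2 + t) * x5 + (2 + t) * x6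
     + t * y1)
    ((- 2 - 2 * t) * x1 + (- 3 - 2 * t) * x2 + 2 * x5 + (2 + t) * x6
     + (1 + 2 * t) * y1)
    ((1 + t) * x1 + (2 + t) * x2 - x5 + (- 1 - t) * x6 - t * y1))).
pose w3 := (Cm (mx3 (1 - t) 0 (- 1 - t) 0 (1 + t) 0 (- 1 - t) 0 0),
   Jm (mx3
    ((1 + 2 * t) * x1 + (2 + t) * x2 + (1 + t) * x6 - t * y1)
    (- x2 + (- 2 - t) * y1)
    ((1 + 2 * t) * x1 + t * x2 + t * y1)
    ((- 2 - t) * x1 + (- 3 - 2 * t) * x2 + (2 + t) * x5 + (1 + 2 * t) * y1)
    (2 * t * x2 + (- 1 - 2 * t) * x5 + 2 * y1)
    (- t * x1 - 2 * t * x2 + t * x5 + (- 1 - t) * y1)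
    ((- 1 - 2 * t) * x1 + (- 2 - 3 * t) * x2 + (2 + t) * x5 + (2 + t) * x6
     + t * y1)
    (t * x1 + 2 * t * x2 - t * x5 + (1 + t) * y1)
    (2 * x1 + 2 * x2 + t * x5 + t * x6))).
pose l := (Cm (mx3 (2 - t) (1 + t) (- 1 - t) (1 + t) (1 + t) 0 (- 1 - t) 0 0),
   Jm (mx3
    ((2 + t) * x1 + (2 + t) * x2 + (1 + t) * x6 - 2 * t * y1 + (- 2 - t) * y3)
    ((- 1 - 2 * t) * x1 + (- 1 - t) * x2 + (- 1 - t) * y1 + (- 1 + t) * y3)
    ((1 + 2 * t) * x1 + t * x2 - y1 + (1 - t) * y3)
    ((- 3 - t) * x1 - 5 * x2 + (2 - t) * x5 + (3 + 3 * t) * y1)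
    (t * x1 + 4 * t * x2 + (- 1 - 3 * t) * x5 + (3 + t) * y1)
    (- t * x1 - 2 * t * x2 + t * x5 + (- 1 - t) * y1)
    ((- 3 - 3 * t) * x1 + (- 4 - 3 * t) * x2 + 3 * x5 + (3 + t) * x6 + t * y1
     + t * y3)
    ((- 2 + t) * x1 + (- 2 + 2 * t) * x2 - 2 * t * x5 - t * x6 + (1 + t) * y1
     + (1 + t) * y3)
    (2 * x1 + 2 * x2 + t * x5 + t * x6 + (- 1 - t) * y3))).
pose r := (Cm (mx3 (2 - t) (1 + t) (- 1 - t) (1 + t) (1 + t) 0 (- 1 - t) 0 0),
   Jm (mx3
    ((4 + 3 * t) * x1 + (2 - t) * x2 + (1 + 2 * t) * x5 + 2 * t * x6)
    ((- 1 - 2 * t) * x1 + (- 3 - t) * x2 - t * x5 + (- 1 - t) * y1)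
    ((1 + 4 * t) * x1 + t * x2 - x5 + (- 1 - t) * x6 - y1)
    ((- 1 + t) * x1 + (- 1 + 2 * t) * x2 - t * x5 + (- 2 - t) * x6
     + (1 + t) * y1)
    (- t * x1 + (- 1 - 2 * t) * x5 + (1 - t) * y1)
    ((- 2 - t) * x1 + (- 2 - 2 * t) * x2 - t * x6 + (- 1 - t) * y1)
    ((- 1 - t) * x1 + (- 2 - 3 * t) * x2 + (2 + t) * x5 + (5 + 2 * t) * x6
     + t * y1)
    (t * x1 + 2 * t * x2 - t * x5 - t * x6 + (1 + t) * y1)
    (2 * x1 + 2 * x2 + t * x5 + 2 * t * x6))).
have -> : (quatA, Jm (persym x1 x2 0 0 x5 x6) * quatA) = a.
  rewrite JmCm conjc_A mx3M; congr (_, Jm _).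
  by apply: mx3_eq; split; ring: t2.
have -> : (quatB, Jm (persym y1 0 y3 0 0 0) * quatB) = b.
  rewrite JmCm conjc_B mx3M; congr (_, Jm _).
  by apply: mx3_eq; split; ring: t2.
have c1 : conjc (- 1 - t) = t by rewrite -conjc_tau conjcK.
have c2 : conjc (1 + t) = - t.
  by rewrite conjc_starD [conjc 1](rmorph1 (@conjc R)) conjc_tau; ring.
have c3 : conjc (1 - t) = 2 + t.
  have -> : 1 - t = 2 + (- 1 - t) by ring.
  by rewrite conjc_starD c1 [conjc 2](rmorph_nat (@conjc R) 2).
have conjE := (rmorphN1 (@conjc R), rmorph1 (@conjc R), rmorph0 (@conjc R),
  conjc_tau, c1, c2, c3).
have aE : dual_dag a = a'.
  rewrite dual_dagE !conjE; congr (Cm _, Jm _);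
  by apply: mx3_eq; split; ring: t2.
have bE : dual_dag b = b'.
  rewrite dual_dagE !conjE; congr (Cm _, Jm _);
  by apply: mx3_eq; split; ring: t2.
have w1E : dual_mul b' a = w1.
  rewrite dual_mulE map_mx3 !conjE !mx3M mx3D; congr (Cm _, Jm _);
  by apply: mx3_eq; split; ring: t2.
have w2E : dual_mul w1 b = w2.
  rewrite dual_mulE map_mx3 !conjE !mx3M mx3D; congr (Cm _, Jm _);
  by apply: mx3_eq; split; ring: t2.
have w3E : dual_mul w2 a' = w3.
  rewrite dual_mulE map_mx3 !conjE !mx3M mx3D; congr (Cm _, Jm _);
  by apply: mx3_eq; split; ring: t2.
have lE : dual_mul w3 b = l.
  rewrite dual_mulE map_mx3 !conjE !mx3M mx3D; congr (Cm _, Jm _);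
  by apply: mx3_eq; split; ring: t2.
have rE : dual_mul a w3 = r.
  rewrite dual_mulE map_mx3 !conjE !mx3M mx3D; congr (Cm _, Jm _);
  by apply: mx3_eq; split; ring: t2.
rewrite /fox /word_l /word_r /word_w aE bE w1E w2E w3E lE rE /= -JmN -JmD mx3N.
by rewrite mx3D; congr (Jm _); apply: mx3_eq; split; ring: t2.
Qed.

End Complexification.

(** * Vanishing of the first cohomology *)
Section Cohomology.
Variable R : realType.
Local Notation C := R[i].
Local Notation M3 := 'M[quat R]_3.
Local Notation Cm := (@quat_mx_of_complex R).
Local Notation t := (tau R).
Implicit Types (z w : C).

(** A linear form in the entries of [Q], with coefficients [P]; this shape gives
    every explicit linear map below a bound for free. *)
Definition mxdot (P Q : 'M[C]_3) : C := \sum_i \sum_j P i j * Q i j.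

Lemma mxdot3 (a b c d e f g h i a' b' c' d' e' f' g' h' i' : C) :
  mxdot (mx3 a b c d e f g h i) (mx3 a' b' c' d' e' f' g' h' i') =
  a * a' + b * b' + c * c' + d * d' + e * e' + f * f' + g * g' + h * h' +
  i * i'.
Proof. rewrite /mxdot !big_ord_recl !big_ord0 !mxE /= !addr0; ring. Qed.

Lemma qnorm_mxdot (P Q : 'M[C]_3) :
  qnorm (jq (mxdot P Q)) <= mnorm (Cm P) * mnorm (Jm Q).
Proof.
have jsum (F : 'I_3 -> C) : qnorm (jq (\sum_k F k)) <= \sum_k qnorm (jq (F k)).
  elim/big_ind2: _ => [|a b c d ab cd|//]; first by rewrite qnorm0.
  by rewrite jqD (le_trans (qnormD _ _)) // lerD.
rewrite /mxdot /mnorm mulr_suml (le_trans (jsum _)) //.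
apply: ler_sum => i _; rewrite mulr_suml (le_trans (jsum _)) //.
apply: ler_sum => j _; rewrite -Cq_jq (le_trans (qnormM _ _)) //.
rewrite mxE ler_wpM2l ?qnorm_ge0 //.
by have := qnorm_le_mnorm (Jm Q) i j; rewrite mxE.
Qed.

(** The entries (0,0), (0,1), (1,0), (1,1), (1,2) and (2,1) of [fox_mx] form an
    invertible 6 by 6 system; the matrices [c1] to [d3] are the rows of its
    inverse. *)
Lemma fox_injective : exists K, forall x1 x2 x5 x6 y1 y3 : C,
  mnorm (Jm (persym x1 x2 0 0 x5 x6)) + mnorm (Jm (persym y1 0 y3 0 0 0)) <=
  K * mnorm (Jm (fox_mx x1 x2 x5 x6 y1 y3)).
Proof.
have t2 := tau_sqr R.
pose c1 : 'M[C]_3 := mx3 ((1 - t) / 3) ((- 5 - 4 * t) / 6) 0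
                        ((2 + t) / 3) 0 (1 + t) 0 (- 1 / 2) 0.
pose c2 : 'M[C]_3 := mx3 0 0 0 (t / 2) (- t / 2) ((- 2 - t) / 2) 0 0 0.
pose c5 : 'M[C]_3 := mx3 (1 + t) (- t) 0 (- 1 + t) 1 (- 2 - t) 0 0 0.
pose c6 : 'M[C]_3 := mx3 ((1 - t) / 3) ((- 1 - 2 * t) / 3) 0
                        ((2 + t) / 3) 0 0 0 (- 1 - t) 0.
pose d1 : 'M[C]_3 := mx3 ((- 4 + t) / 6) ((4 + 5 * t) / 6) 0
                        ((- 2 - 7 * t) / 6) (- 1 / 2) (1 / 2) 0 ((1 + t) / 2) 0.
pose d3 : 'M[C]_3 := mx3 ((- 2 - t) / 3) ((- 1 + t) / 3) 0
                        ((- 1 - 2 * t) / 3) 0 (- t) 0 0 0.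
exists (2 * mnorm (Cm c1) + 2 * mnorm (Cm c2) + mnorm (Cm c5) +
        mnorm (Cm c6) + 2 * mnorm (Cm d1) + mnorm (Cm d3)).
move=> x1 x2 x5 x6 y1 y3; set F := fox_mx _ _ _ _ _ _.
have x1E : x1 = mxdot c1 F by rewrite mxdot3; field: t2.
have x2E : x2 = mxdot c2 F by rewrite mxdot3; field: t2.
have x5E : x5 = mxdot c5 F by rewrite mxdot3; field: t2.
have x6E : x6 = mxdot c6 F by rewrite mxdot3; field: t2.
have y1E : y1 = mxdot d1 F by rewrite mxdot3; field: t2.
have y3E : y3 = mxdot d3 F by rewrite mxdot3; field: t2.
have := qnorm_mxdot c1 F; have := qnorm_mxdot c2 F.
have := qnorm_mxdot c5 F; have := qnorm_mxdot c6 F.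
have := qnorm_mxdot d1 F; have := qnorm_mxdot d3 F.
rewrite -x1E -x2E -x5E -x6E -y1E -y3E /Jm !map_mx3 !mnorm_mx3 jq0 qnorm0.
by clear; lra.
Qed.

Lemma coboundary_A (z1 z2 z3 z4 z5 z6 : C) :
  let xi := Jm (persym z1 z2 z3 z4 z5 z6) in
  xi - quatA R * xi * dag (quatA R) = Jm (persym (- z4 - t * z6)
    (z1 + (1 - t) * z4 - z5 + t * z6)
    (- 2 * t * z1 - 2 * z2 - 2 * t * z4 - z5 + (1 + t) * z6)
    z6 (2 * z4 - z6) 0).
Proof.
have t2 := tau_sqr R; rewrite /=.
have -> : dag (quatA R) = Cm (mx3 1 (- 1) (- 1 - t) 0 1 1 0 0 1).
  rewrite /quatA /quat_mx_of_complex !map_mx3 dag_mx3.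
  rewrite -!quat_of_complex_star star_tau !star1 !star0.
  by rewrite [star (- 1)](rmorphN1 (@conjc R)).
rewrite CmJm JmCm !map_mx3 -JmN -JmD; congr Jm.
have -> : conjc (- 1 - t) = t by rewrite -conjc_tau conjcK.
rewrite (rmorphN1 (@conjc R)) (rmorph1 (@conjc R)) (rmorph0 (@conjc R)).
rewrite /persym !mx3M mx3N mx3D.
by apply: mx3_eq; split; ring: t2.
Qed.

Lemma coboundary_B (z1 z2 z3 z4 z5 z6 : C) :
  let xi := Jm (persym z1 z2 z3 z4 z5 z6) in
  xi - quatB R * xi * dag (quatB R) = Jm (persym (z2 - t * z3) (- z3) 0
    (- z1 + (1 - t) * z2 - t * z3 + z5) (- 2 * z2 - z3)
    (- 2 * t * z1 + 2 * t * z2 + (1 + t) * z3 + 2 * z4 - z5)).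
Proof.
have t2 := tau_sqr R; rewrite /=.
have -> : dag (quatB R) = Cm (mx3 1 0 0 (- 1) 1 0 (- 1 - t) 1 1).
  rewrite /quatB /quat_mx_of_complex !map_mx3 dag_mx3.
  rewrite -!quat_of_complex_star star_tau !star1 !star0.
  by rewrite [star (- 1)](rmorphN1 (@conjc R)).
rewrite CmJm JmCm !map_mx3 -JmN -JmD; congr Jm.
have -> : conjc (- 1 - t) = t by rewrite -conjc_tau conjcK.
rewrite (rmorphN1 (@conjc R)) (rmorph1 (@conjc R)) (rmorph0 (@conjc R)).
rewrite /persym !mx3M mx3N mx3D.
by apply: mx3_eq; split; ring: t2.
Qed.

(** The six coordinates [x3], [x4], [y2], [y4], [y5], [y6] are chosen so that
    coboundaries, which form a space of dimension six, are determined by them;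
    solving for the coboundary with the opposite coordinates gives [xi] with
    coefficients in Q(tau). *)
Lemma coboundary_slice : exists K,
  forall x1 x2 x3 x4 x5 x6 y1 y2 y3 y4 y5 y6 : C,
  let sA := Jm (persym x1 x2 x3 x4 x5 x6) in
  let sB := Jm (persym y1 y2 y3 y4 y5 y6) in
  exists z1 z2 z3 z4 z5 z6 : C, let xi := Jm (persym z1 z2 z3 z4 z5 z6) in
  [/\ mnorm xi <= K * (mnorm sA + mnorm sB),
      exists u1 u2 u5 u6, sA + (xi - quatA R * xi * dag (quatA R)) =
                          Jm (persym u1 u2 0 0 u5 u6) &
      exists v1 v3, sB + (xi - quatB R * xi * dag (quatB R)) =
                    Jm (persym v1 0 v3 0 0 0)].
Proof.
have t2 := tau_sqr R.
pose a1 : 'M[C]_3 := mx3 0 0 ((- 2 - t) / 3) ((1 + 2 * t) / 3) 0 0 0 0 0.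
pose b1 : 'M[C]_3 := mx3 0 ((- 1 - t) / 2) 0 ((- 1 - 2 * t) / 3)
                        ((1 + t) / 2) 0 ((1 - t) / 3) 0 0.
pose b2 : 'M[C]_3 := mx3 0 (- 1 / 2) 0 0 (1 / 2) 0 0 0 0.
pose b3 : 'M[C]_3 := mx3 0 1 0 0 0 0 0 0 0.
pose a4 : 'M[C]_3 := mx3 0 0 (- t / 2) (- 1 / 2) 0 0 0 0 0.
pose b4 : 'M[C]_3 := mx3 0 0 0 0 (- 1 / 2) 0 (t / 2) 0 0.
pose b5 : 'M[C]_3 := mx3 0 0 0 ((- 4 - 2 * t) / 3) t 0 ((1 - t) / 3) 0 0.
pose a6 : 'M[C]_3 := mx3 0 0 0 (- 1) 0 0 0 0 0.
pose k1 := mnorm (Cm a1) + mnorm (Cm b1).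
pose k2 := mnorm (Cm 0) + mnorm (Cm b2).
pose k3 := mnorm (Cm 0) + mnorm (Cm b3).
pose k4 := mnorm (Cm a4) + mnorm (Cm b4).
pose k5 := mnorm (Cm a1) + mnorm (Cm b5).
pose k6 := mnorm (Cm a6) + mnorm (Cm 0).
exists (2 * k1 + 2 * k2 + k3 + 2 * k4 + k5 + k6).
move=> x1 x2 x3 x4 x5 x6 y1 y2 y3 y4 y5 y6 sA sB.
pose X := persym x1 x2 x3 x4 x5 x6; pose Y := persym y1 y2 y3 y4 y5 y6.
pose z a b := mxdot a X + mxdot b Y.
have z0 P : mxdot 0 P = 0.
  by rewrite /mxdot big1 // => i _; rewrite big1 // => j _; rewrite mxE mul0r.
have zK a b : qnorm (jq (z a b)) <=
    (mnorm (Cm a) + mnorm (Cm b)) * (mnorm sA + mnorm sB).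
  rewrite jqD (le_trans (qnormD _ _)) //.
  have := qnorm_mxdot a X; have := qnorm_mxdot b Y.
  rewrite -/sA -/sB mulrDl !mulrDr.
  have := mulr_ge0 (mnorm_ge0 (Cm a)) (mnorm_ge0 sB).
  have := mulr_ge0 (mnorm_ge0 (Cm b)) (mnorm_ge0 sA).
  by rewrite /sA /sB /X /Y; clear; lra.
exists (z a1 b1), (z 0 b2), (z 0 b3), (z a4 b4), (z a1 b5), (z a6 0).
move=> xi; split.
- rewrite /xi /Jm map_mx3 mnorm_mx3 /k1 /k2 /k3 /k4 /k5 /k6.
  have := zK a1 b1; have := zK 0 b2; have := zK 0 b3; have := zK a4 b4.
  have := zK a1 b5; have := zK a6 0; clear; lra.
- rewrite coboundary_A /sA -JmD /persym mx3D.
  do 4 eexists; congr Jm; apply: mx3_eq; split; try reflexivity;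
  by rewrite /z !z0 !mxdot3; field: t2.
- rewrite coboundary_B /sB -JmD /persym mx3D.
  do 2 eexists; congr Jm; apply: mx3_eq; split; try reflexivity;
  by rewrite /z !z0 !mxdot3; field: t2.
Qed.

End Cohomology.

(** * Isometries and their tangent vectors *)
Section Isometries.
Variable R : realType.
Local Notation C := R[i].
Local Notation M3 := 'M[quat R]_3.
Implicit Types (X Y g h : M3).

Definition isoJ_mx g := dag g * g = 1 /\ g * dag g = 1.

Lemma isoJ_mx1 : isoJ_mx 1.
Proof. by rewrite /isoJ_mx dag1 mulr1. Qed.

Lemma isoJ_mxM g h : isoJ_mx g -> isoJ_mx h -> isoJ_mx (g * h).
Proof.
move=> [g1 g2] [h1 h2]; rewrite /isoJ_mx dagM; split.
  by rewrite -mulrA (mulrA (dag g)) g1 mul1r.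
by rewrite -mulrA (mulrA h) h2 mul1r.
Qed.

Lemma isoJ_mxV g : isoJ_mx g -> isoJ_mx (dag g).
Proof. by move=> [g1 g2]; rewrite /isoJ_mx dagK. Qed.

Lemma quatA_isoJ : isoJ_mx (quatA R).
Proof.
have AP : quatA R \in isometryJ (K := quat R).
  exact/quat_mx_of_complex_isometryJ/rho0_a_isometryJ.
rewrite /isoJ_mx -inv_isoJ_mxE.
by split; [exact: isometryJ_mulV|exact: isometryJ_mulrV].
Qed.

Lemma quatB_isoJ : isoJ_mx (quatB R).
Proof.
have BP : quatB R \in isometryJ (K := quat R).
  exact/quat_mx_of_complex_isometryJ/rho0_b_isometryJ.
rewrite /isoJ_mx -inv_isoJ_mxE.
by split; [exact: isometryJ_mulV|exact: isometryJ_mulrV].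
Qed.

Lemma mx3_eta (X : M3) : exists a b c d e f g h i : quat R,
  X = mx3 a b c d e f g h i.
Proof.
pose o0 : 'I_3 := ord0; pose o1 : 'I_3 := lift ord0 ord0.
pose o2 : 'I_3 := lift ord0 (lift ord0 ord0).
exists (X o0 o0), (X o0 o1), (X o0 o2), (X o1 o0), (X o1 o1), (X o1 o2),
  (X o2 o0), (X o2 o1), (X o2 o2).
by apply/matrixP => -[[|[|[|//]]] ?] [[|[|[|//]]] ?]; rewrite mxE /=;
  congr (X _ _); exact: val_inj.
Qed.

(** Three entries of a persymmetric matrix are copies of three others.  Taking
    the latter from [X], the former differ from those of [X] by entries of
    [X + dag X]. *)
Lemma skew_near X : jpart_mx X = X ->
  exists x1 x2 x3 x4 x5 x6 : C,
    mnorm (X - Jm (persym x1 x2 x3 x4 x5 x6)) <= mnorm (X + dag X).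
Proof.
have [a [b [c [d [e [f [g [h [i ->]]]]]]]]] := mx3_eta X.
rewrite /jpart_mx map_mx3 => jX.
have jpartP (x : quat R) : exists z : C, jpart x = jq z.
  by exists (Complex (qj x) (qk x)).
have [a' ja] := jpartP a; have [b' jb] := jpartP b; have [c' jc] := jpartP c.
have [d' jd] := jpartP d; have [e' je] := jpartP e; have [f' jf] := jpartP f.
have [g' jg] := jpartP g; have [h' jh] := jpartP h; have [i' ji] := jpartP i.
exists a', b', c', d', e', g'.
rewrite -jX dag_mx3 ja jb jc jd je jf jg jh ji /Jm map_mx3 mx3N !mx3D.
rewrite !mnorm_mx3 !subrr qnorm0 !jq_star !jqN.
have := qnorm_ge0 (jq a' - jq i'); have := qnorm_ge0 (jq b' - jq f').
have := qnorm_ge0 (jq c' - jq c'); have := qnorm_ge0 (jq d' - jq h').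
have := qnorm_ge0 (jq e' - jq e'); have := qnorm_ge0 (jq g' - jq g').
by clear; lra.
Qed.

(** Differentiating [dag X * X = 1] shows that the j-part of an isometry,
    translated back to the identity by [dag X0], is skew up to the error. *)
Lemma first_order_skew (eta f k : R) X X0 :
  0 <= f -> f <= eta -> eta <= 1 -> isoJ_mx X0 -> isoJ_mx X ->
  first_order eta f k X (X0, jpart_mx X) ->
  exists x1 x2 x3 x4 x5 x6 : C,
    first_order eta f (k + 6 * k ^+ 5) X
      (X0, Jm (persym x1 x2 x3 x4 x5 x6) * X0).
Proof.
move=> f0 feta eta1 [X0V VX0] [XV _] aX.
have k_ge0 := first_order_ge0 aX.
set al := jpart_mx X in aX *; pose s := al * dag X0.
have js : jpart_mx s = s.
  case: aX => _ _ _ _ /= jX0.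
  rewrite /s jpart_mxM jpart_dag jX0 dag0 mulr0 add0r.
  have -> : jpart_mx al = al by apply/matrixP => i j; rewrite !mxE.
  congr (_ * _); rewrite -[RHS]cpartD_jpart_mx jpart_dag jX0 dag0 addr0 //.
have [x1 [x2 [x3 [x4 [x5 [x6 xP]]]]]] := skew_near js.
exists x1, x2, x3, x4, x5, x6; set sg := Jm _ in xP *.
have sX0 : s * X0 = al by rewrite /s -mulrA X0V mulr1.
have U : mnorm (dag X0 * al + dag al * X0) <= 6 * k * k * eta * f.
  have [_ + _ _ _] := first_orderM f0 feta eta1 (first_order_dag aX) aX.
  rewrite XV /=; have -> : jpart_mx 1 = 0 :> M3.
    apply/matrixP => i j; rewrite !mxE; case: eqP => _ //.
  by rewrite sub0r mnormN.
have {}aX0 : mnorm X0 <= k by case: aX.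
have sgs : mnorm (s - sg) <= k * (6 * k * k * eta * f) * k.
  apply: le_trans xP _.
  have -> : s + dag s = X0 * (dag X0 * al + dag al * X0) * dag X0.
    rewrite mulrDr mulrDl !mulrA VX0 mul1r -/s; congr (_ + _).
    by rewrite -!mulrA VX0 mulr1 /s dagM dagK.
  apply: mnormM_le; last by rewrite mnorm_dag.
  exact: mnormM_le.
have alsg : mnorm (al - sg * X0) <= 6 * k ^+ 5 * eta * f.
  rewrite -sX0 -mulrBl; apply: le_trans (mnormM_le sgs aX0) _.
  by rewrite le_eqVlt; apply/orP; left; apply/eqP; ring.
have k5 : 0 <= k ^+ 5 * f by rewrite mulr_ge0 ?exprn_ge0.
have eta_ge0 := le_trans f0 feta.
have k5e : 0 <= k ^+ 5 * eta by rewrite mulr_ge0 ?exprn_ge0.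
have k5ef : 0 <= k ^+ 5 * f * (1 - eta) by rewrite mulr_ge0 // subr_ge0.
have ke : 0 <= k * f * eta by rewrite !mulr_ge0.
case: aX => X1 X2 al2 X3 X4; split => //=.
- by move: X1 k5e => /=; clear; lra.
- rewrite (le_trans (_ : _ <= 6 * k ^+ 5 * eta * f)) //.
  by move: ke; clear; lra.
- rewrite -[sg * X0](subKr al) (le_trans (mnormB _ _)) //.
  by move: alsg al2 k5ef => /=; clear; lra.
- by move: X3 (exprn_ge0 5 k_ge0) => /=; clear; lra.
Qed.

End Isometries.

(** * Isometries with a prescribed tangent vector *)
Section Exponential.
Variable R : realType.
Local Notation C := R[i].
Local Notation M3 := 'M[quat R]_3.
Implicit Types (X Y g h : M3) (z : C).

Lemma one_mx3 : 1 = mx3 1 0 0 0 1 0 0 0 1 :> M3.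
Proof. exact: mx3_1. Qed.

Definition sqnorm z : R := complex.Re z ^+ 2 + complex.Im z ^+ 2.

Lemma sqnorm_ge0 z : 0 <= sqnorm z.
Proof. by rewrite addr_ge0 ?sqr_ge0. Qed.

Lemma sqnorm_le z : sqnorm z <= qnorm (jq z) ^+ 2.
Proof.
case: z => a b; rewrite /sqnorm /qnorm /= normr0 !add0r.
rewrite sqrrD !real_normK ?num_real //.
by rewrite lerD2r lerDl mulrn_wge0 // mulr_ge0.
Qed.

(** The Cayley transform of [z j / 2]: a unit quaternion equal to [1 + z j] at
    the first order, whose coordinates are rational in those of [z]. *)
Definition unitq z : quat R :=
  let N := sqnorm z / 4 in
  Quat ((1 - N) / (1 + N)) 0 (complex.Re z / (1 + N)) (complex.Im z / (1 + N)).

Lemma unitqP z : star (unitq z) * unitq z = 1 /\ unitq z * star (unitq z) = 1.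
Proof.
have N0 : 1 + sqnorm z / 4 != 0.
  by rewrite gt_eqF // ltr_pwDl // divr_ge0 ?sqnorm_ge0.
case: z N0 => a b; rewrite /sqnorm /unitq /= => N0.
have N0' : 4 + (a ^+ 2 + b ^+ 2) != 0.
  by apply: contra N0 => /eqP ab; apply/eqP; lra.
by split; congr Quat; rewrite /sqnorm /=; field; rewrite ?N0' //.
Qed.

Lemma unitq_near (f m : R) z : 0 <= f -> f <= 1 -> 1 <= m ->
  qnorm (jq z) <= m * f ->
  qnorm (unitq z - 1) <= 2 * m ^+ 2 * f /\
  qnorm (jpart (unitq z - jq z)) <= m ^+ 3 * f * f.
Proof.
move=> f0 f1 m1 zf.
pose N := sqnorm z / 4; have N0 : 0 <= N by rewrite divr_ge0 ?sqnorm_ge0.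
have N1 : 0 < 1 + N by rewrite ltr_pwDl.
have Nle : N <= (m * f) ^+ 2 / 4.
  rewrite ler_pM2r ?invr_gt0 // (le_trans (sqnorm_le z)) //.
  by rewrite ler_pXn2r ?nnegrE ?qnorm_ge0 // (le_trans _ zf) ?qnorm_ge0.
have d1 : (1 - N) / (1 + N) - 1 = - (2 * N / (1 + N)) by field; rewrite gt_eqF.
have ND : N / (1 + N) <= N by rewrite ler_pdivrMr // ler_peMr // lerDl.
have ND0 : 0 <= N / (1 + N) by rewrite divr_ge0 // ltW.
have mf : 0 <= m * f by rewrite mulr_ge0 // (le_trans _ m1).
have mf2 : (m * f) ^+ 2 <= m ^+ 2 * f.
  by rewrite exprMn ler_wpM2l ?sqr_ge0 // expr2 ler_piMl.
have mf1 : m * f <= m ^+ 2 * f.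
  by rewrite ler_wpM2r // expr2 ler_peMl // (le_trans _ m1).
have shrink (x : R) : `|x / (1 + N)| <= `|x|.
  rewrite normrM normfV (gtr0_norm N1) ler_pdivrMr // ler_peMr ?normr_ge0 //.
  by rewrite lerDl.
have shrink' (x : R) : `|x / (1 + N) - x| <= N * `|x|.
  have -> : x / (1 + N) - x = - (x * (N / (1 + N))).
    by field; rewrite gt_eqF.
  by rewrite normrN normrM (ger0_norm ND0) mulrC ler_wpM2r.
split.
  rewrite /qnorm /= -/N d1 normrN ger0_norm; last first.
    by rewrite -mulrA mulr_ge0.
  have := shrink (complex.Re z); have := shrink (complex.Im z).
  move: zf; rewrite /qnorm /= !oppr0 !addr0 normr0 !add0r.
  move: ND Nle mf2 mf mf1; rewrite -mulrA.
  move: (N / (1 + N)) `|complex.Re z / (1 + N)| `|complex.Im z / (1 + N)|.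
  by clear; move=> *; lra.
have := shrink' (complex.Re z); have := shrink' (complex.Im z).
rewrite /qnorm /= -/N normr0 !add0r => I1 I2.
apply: le_trans (lerD I2 I1) _; rewrite -mulrDr.
have zf' : `|complex.Re z| + `|complex.Im z| <= m * f.
  by move: zf; rewrite /qnorm /= normr0 !add0r.
have Nle' : N <= m ^+ 2 * f.
  by move: Nle mf2 (mulr_ge0 (sqr_ge0 m) f0); clear; lra.
have -> : m ^+ 3 * f * f = m ^+ 2 * f * (m * f) by ring.
by rewrite ler_pM // addr_ge0.
Qed.

(** Matrices at distance O(f) from the identity have a single scale, hence
    [eta = f]. *)
Lemma first_order1 (f K : R) g X :
  0 <= f -> f <= 1 -> 3 <= K ->
  mnorm (g - 1) <= K * f -> mnorm (jpart_mx g - X) <= K * f * f ->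
  mnorm X <= K * f -> first_order f f K g (1, X).
Proof.
move=> f0 f1 K3 g1 gX Xf; split => //=; first by rewrite mnorm1.
by apply/matrixP => i j; rewrite !mxE; case: eqP.
Qed.

Lemma isometry_diag (f m : R) z w : 0 <= f -> f <= 1 -> 1 <= m ->
  qnorm (jq z) <= m * f -> qnorm (jq w) <= m * f ->
  exists2 g, isoJ_mx g &
    first_order f f (6 * m ^+ 3) g (1, Jm (persym z 0 0 0 w 0)).
Proof.
move=> f0 f1 m1 zf wf.
have [zz zz'] := unitqP z; have [ww ww'] := unitqP w.
exists (mx3 (unitq z) 0 0 0 (unitq w) 0 0 0 (unitq z)).
  rewrite /isoJ_mx dag_mx3 !star0 -!mulmxE !mx3M one_mx3.
  by rewrite !(mulr0, mul0r, addr0, add0r) zz zz' ww ww'.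
have [z1 z2] := unitq_near f0 f1 m1 zf.
have [w1 w2] := unitq_near f0 f1 m1 wf.
have m23 : m ^+ 2 * f <= m ^+ 3 * f.
  by rewrite ler_wpM2r // [leRHS]exprS ler_peMl // sqr_ge0.
have m12 : m * f <= m ^+ 2 * f.
  by rewrite ler_wpM2r // expr2 ler_peMl // (le_trans _ m1).
have m3 : 1 <= m ^+ 3 by rewrite exprn_ege1.
have m3f : 0 <= m ^+ 3 * f by rewrite mulr_ge0 // (le_trans _ m3).
have m3ff : 0 <= m ^+ 3 * f * f by rewrite mulr_ge0.
apply: first_order1 => //.
- by lra.
- rewrite one_mx3 mx3N mx3D mnorm_mx3 !subr0 qnorm0.
  by move: z1 w1 m23; clear; lra.
- rewrite /jpart_mx /Jm !map_mx3 mx3N mx3D mnorm_mx3.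
  have j0 : jpart 0 - jq 0 = 0 :> quat R by rewrite jq0 subr0.
  rewrite !j0 qnorm0.
  by move: z2 w2 m3ff; rewrite !jpartB !jpart_jq; clear; lra.
- rewrite /Jm map_mx3 mnorm_mx3 !jq0 qnorm0.
  by move: zf wf m12 m23 m3f; clear; lra.
Qed.

(** These unipotent isometries are horospherical translations: the real part of
    the corner entry is forced by the entry [z j]. *)
Lemma isometry_upper (f m : R) z w : 0 <= f -> f <= 1 -> 1 <= m ->
  qnorm (jq z) <= m * f -> qnorm (jq w) <= m * f ->
  exists2 g, isoJ_mx g &
    first_order f f (6 * m ^+ 3) g (1, Jm (persym 0 z w 0 0 0)).
Proof.
move=> f0 f1 m1 zf wf.
pose c : quat R := Quat (- (sqnorm z / 2)) 0 (complex.Re w) (complex.Im w).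
have cE : star c + c = jq z * jq z.
  by case: z @c {zf} => a b; congr Quat; rewrite /sqnorm /=; field.
have zS : star (jq z) = - jq z by rewrite jq_star jqN.
exists (mx3 1 (jq z) c 0 1 (jq z) 0 0 1).
  rewrite /isoJ_mx dag_mx3 !star0 !star1 zS -!mulmxE !mx3M one_mx3.
  rewrite !(mulr0, mul0r, mulr1, mul1r, addr0, add0r) !(subrr, addNr).
  split; apply: mx3_eq; split=> //.
    by rewrite addrAC mulNr [c + _]addrC cE subrr.
  by rewrite addrAC mulrN cE subrr.
have z2 : sqnorm z <= m ^+ 2 * f.
  rewrite (le_trans (sqnorm_le z)) // (le_trans (_ : _ <= (m * f) ^+ 2)) //.
    by rewrite ler_pXn2r ?nnegrE ?qnorm_ge0 // (le_trans _ zf) ?qnorm_ge0.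
  by rewrite exprMn ler_wpM2l ?sqr_ge0 // expr2 ler_piMl.
have cf : qnorm c <= m ^+ 2 * f + m * f.
  have cN : `|- (sqnorm z / 2)| = sqnorm z / 2.
    by rewrite normrN ger0_norm // divr_ge0 ?sqnorm_ge0.
  move: z2 (sqnorm_ge0 z) wf; rewrite /qnorm /= normr0 cN !addr0 !add0r.
  by clear; lra.
have m23 : m ^+ 2 * f <= m ^+ 3 * f.
  by rewrite ler_wpM2r // [leRHS]exprS ler_peMl // sqr_ge0.
have m12 : m * f <= m ^+ 2 * f.
  by rewrite ler_wpM2r // expr2 ler_peMl // (le_trans _ m1).
have m3 : 1 <= m ^+ 3 by rewrite exprn_ege1.
have m3f : 0 <= m ^+ 3 * f by rewrite mulr_ge0 // (le_trans _ m3).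
have m3ff : 0 <= m ^+ 3 * f * f by rewrite mulr_ge0.
apply: first_order1 => //.
- by lra.
- rewrite one_mx3 mx3N mx3D mnorm_mx3 !subr0 !subrr qnorm0.
  by move: zf cf m12 m23 m3f; clear; lra.
- have -> : jpart_mx (mx3 1 (jq z) c 0 1 (jq z) 0 0 1) =
            Jm (persym 0 z w 0 0 0).
    by rewrite /jpart_mx /Jm !map_mx3.
  by rewrite subrr mnorm0; move: m3ff; clear; lra.
- rewrite /Jm map_mx3 mnorm_mx3 !jq0 qnorm0.
  by move: zf wf m12 m23 m3f; clear; lra.
Qed.

(** Conjugation by [J] exchanges upper and lower triangular matrices. *)
Lemma isometry_lower (f m : R) z w : 0 <= f -> f <= 1 -> 1 <= m ->
  qnorm (jq z) <= m * f -> qnorm (jq w) <= m * f ->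
  exists2 g, isoJ_mx g &
    first_order f f (1944 * m ^+ 3) g (1, Jm (persym 0 0 0 z 0 w)).
Proof.
move=> f0 f1 m1 zf wf; have [g gI gO] := isometry_upper f0 f1 m1 zf wf.
pose J := formJ (quat R).
have JJ : J * J = 1 by exact: formJ2.
have dJ : dag J = J by rewrite /J /formJ dag_mx3 star0 star1.
have jJ : jpart_mx J = 0.
  rewrite /jpart_mx /J /formJ map_mx3.
  by apply/matrixP => -[[|[|[|//]]] ?] [[|[|[|//]]] ?]; rewrite !mxE.
have JO : first_order f f 3 J (J, 0).
  have f9 : 0 <= 3 * f by rewrite mulr_ge0.
  split => /=; rewrite ?subrr ?subr0 ?mnorm0 //.
  - by rewrite jJ mnorm0 mulr_ge0.
  - by rewrite /J /formJ mnorm_mx3 qnorm0 qnorm1; lra.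
exists (J * g * J).
  by apply: isoJ_mxM; [apply: isoJ_mxM => //|]; rewrite /isoJ_mx dJ.
have := first_orderM f0 (lexx f) f1 (first_orderM f0 (lexx f) f1 JO gO) JO.
rewrite /dual_mul /= mulr1 mul0r JJ addr0 mulr0 add0r => gO'.
have -> : Jm (persym 0 0 0 z 0 w) = J * Jm (persym 0 z w 0 0 0) * J.
  rewrite /J /formJ /Jm !map_mx3 -!mulmxE !mx3M.
  by rewrite !(mulr0, mul0r, mulr1, mul1r, addr0, add0r).
apply: first_order_le gO' => //.
by rewrite le_eqVlt; apply/orP; left; apply/eqP; ring.
Qed.

Lemma first_order_trans (f eta k : R) X p : 0 <= f -> f <= eta ->
  first_order f f k X p -> first_order eta f k X p.
Proof.
move=> f0 feta aX; have k0 := first_order_ge0 aX.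
case: aX => X1 X2 p2 p1 p0; split=> //.
  by rewrite (le_trans X1) // ler_wpM2l.
by rewrite (le_trans X2) // ler_wpM2r // ler_wpM2l.
Qed.

(** A substitute for the exponential of V: the product of two unipotent
    isometries and a diagonal one has any given tangent vector in V, and is
    given by rational functions. *)
Lemma isometry_of_tangent (m : R) : 1 <= m -> exists K, forall f,
  0 <= f -> f <= 1 -> forall z1 z2 z3 z4 z5 z6 : C,
  mnorm (Jm (persym z1 z2 z3 z4 z5 z6)) <= m * f ->
  exists2 g, isoJ_mx g & first_order f f K g (1, Jm (persym z1 z2 z3 z4 z5 z6)).
Proof.
move=> m1; pose k := m ^+ 3.
exists (6 * (6 * (6 * k) * (1944 * k)) * (6 * k)).
move=> f f0 f1 z1 z2 z3 z4 z5 z6 zf.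
have entry i j : qnorm (jq (persym z1 z2 z3 z4 z5 z6 i j)) <= m * f.
  apply: le_trans zf.
  have := qnorm_le_mnorm (Jm (persym z1 z2 z3 z4 z5 z6)) i j.
  by rewrite mxE.
pose o0 : 'I_3 := ord0; pose o1 : 'I_3 := lift ord0 ord0.
pose o2 : 'I_3 := lift ord0 (lift ord0 ord0).
have e1 := entry o0 o0; have e2 := entry o0 o1; have e3 := entry o0 o2.
have e4 := entry o1 o0; have e5 := entry o1 o1; have e6 := entry o2 o0.
rewrite !mxE /= in e1 e2 e3 e4 e5 e6.
have [g gI gO] := isometry_upper f0 f1 m1 e2 e3.
have [h hI hO] := isometry_lower f0 f1 m1 e4 e6.
have [d dI dO] := isometry_diag f0 f1 m1 e1 e5.
exists (g * h * d); first exact/isoJ_mxM/dI/isoJ_mxM.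
have := first_orderM f0 (lexx f) f1 (first_orderM f0 (lexx f) f1 gO hO) dO.
rewrite /dual_mul /= !mulr1 !mul1r -!JmD /persym !mx3D.
by rewrite !(addr0, add0r).
Qed.

End Exponential.

(** * One step of Newton's method *)
Section Improvement.
Variable R : realType.
Local Notation C := R[i].
Local Notation M3 := 'M[quat R]_3.
Implicit Types (X Y a b g h : M3).

Definition conjg_mx g X := g * X * dag g.

Lemma conjg_mxM g X Y : isoJ_mx g ->
  conjg_mx g (X * Y) = conjg_mx g X * conjg_mx g Y.
Proof.
by move=> [gg _]; rewrite /conjg_mx -!mulrA (mulrA (dag g) g) gg mul1r.
Qed.

Lemma conjg_mx_dag g X : conjg_mx g (dag X) = dag (conjg_mx g X).
Proof. by rewrite /conjg_mx !dagM dagK mulrA. Qed.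

Lemma conjg_mx_isoJ g X : isoJ_mx g -> isoJ_mx X -> isoJ_mx (conjg_mx g X).
Proof. by move=> gI XI; apply: isoJ_mxM (isoJ_mxV gI); exact: isoJ_mxM. Qed.

Lemma conjg_mx_comp g h X : conjg_mx (g * h) X = conjg_mx g (conjg_mx h X).
Proof. by rewrite /conjg_mx dagM !mulrA. Qed.

Definition fig8_rel a b := word_l *%R (@dag R) a b = word_r *%R (@dag R) a b.

Lemma fig8_rel_conj g a b : isoJ_mx g ->
  fig8_rel a b -> fig8_rel (conjg_mx g a) (conjg_mx g b).
Proof.
move=> gI; rewrite /fig8_rel /word_l /word_r /word_w => rel.
by rewrite -!conjg_mx_dag -!conjg_mxM // rel.
Qed.

Lemma dag_Jm_persym (z1 z2 z3 z4 z5 z6 : C) :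
  dag (Jm (persym z1 z2 z3 z4 z5 z6)) = - Jm (persym z1 z2 z3 z4 z5 z6).
Proof. by rewrite /Jm map_mx3 dag_mx3 mx3N !jq_star !jqN. Qed.

(** At the first order, conjugation by [1 + xi] adds the coboundary of [xi], in
    the trivialisation where a tangent vector at [X0] is written [sg * X0]. *)
Lemma first_order_conj (eta f k l : R) g a X0 (z1 z2 z3 z4 z5 z6 : C) sg :
  0 <= f -> f <= eta -> eta <= 1 -> isoJ_mx X0 ->
  let xi := Jm (persym z1 z2 z3 z4 z5 z6) in
  first_order eta f k g (1, xi) -> first_order eta f l a (X0, sg * X0) ->
  first_order eta f (6 * (6 * k * l) * k) (conjg_mx g a)
    (X0, (sg + (xi - X0 * xi * dag X0)) * X0).
Proof.
move=> f0 feta eta1 [X0V _] xi gO aO.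
have := first_orderM f0 feta eta1 (first_orderM f0 feta eta1 gO aO)
  (first_order_dag gO).
rewrite /dual_mul /dual_dag /= dag1 dag_Jm_persym -/xi !mulr1 !mul1r.
have -> : X0 * - xi + (sg * X0 + xi * X0) =
  (sg + (xi - X0 * xi * dag X0)) * X0 => [|//].
by rewrite !mulrDl mulNr -!mulrA X0V mulr1 addrC -addrA mulrN.
Qed.

(** The linearised relator is applied to the pair after conjugation, which still
    satisfies the relation and whose tangent pair lies in the slice where [fox]
    is injective. *)
Lemma improvement : exists2 K : R, 1 <= K & forall (eta : R) a b,
  isoJ_mx a -> isoJ_mx b -> fig8_rel a b ->
  mnorm (a - quatA R) + mnorm (b - quatB R) <= eta -> eta <= 1 ->
  let f := mnorm (jpart_mx a) + mnorm (jpart_mx b) in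
  exists g, [/\ isoJ_mx g, mnorm (g - 1) <= K * f &
    mnorm (jpart_mx (conjg_mx g a)) + mnorm (jpart_mx (conjg_mx g b)) <=
    K * eta * f].
Proof.
(* The constants of the approximations: [k0] for the given pair, [k1] once its
   j-parts are replaced by skew ones, [k2] after the conjugation. *)
pose k0 : R := 1 + mnorm (quatA R) + mnorm (quatB R).
pose k1 := k0 + 6 * k0 ^+ 5.
have [Ks slice] := coboundary_slice R.
pose m := 1 + `|Ks| * (2 * k1 ^+ 2).
have nA := mnorm_ge0 (quatA R); have nB := mnorm_ge0 (quatB R).
have k0_ge1 : 1 <= k0 by rewrite /k0; lra.
have k0_ge0 : 0 <= k0 by rewrite (le_trans _ k0_ge1).
have k1_ge0 : 0 <= k1 by rewrite addr_ge0 // mulr_ge0 // exprn_ge0.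
have m_ge1 : 1 <= m by rewrite lerDl !mulr_ge0 // exprn_ge0.
have [Kt tangent] := isometry_of_tangent m_ge1.
pose k2 := 6 * (6 * Kt * k1) * Kt.
pose Kf := 2 * (6 * (6 * (6 * (6 * k2 * k2) * k2) * k2) * k2).
have [Kj injK] := fox_injective R.
exists (1 + `|Kt| + 2 * `|k2| + k0 * (`|Kj| * `|Kf|)).
  by rewrite -!addrA lerDl !addr_ge0 // !mulr_ge0.
move=> eta a b aI bI rel abeta eta1 f.
have jA : jpart_mx (quatA R) = 0 by exact: jpart_Cm.
have jB : jpart_mx (quatB R) = 0 by exact: jpart_Cm.
have fa : mnorm (jpart_mx a) <= mnorm (a - quatA R).
  by rewrite -[jpart_mx a]subr0 -jA -jpart_mxB mnorm_jpart.
have fb : mnorm (jpart_mx b) <= mnorm (b - quatB R).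
  by rewrite -[jpart_mx b]subr0 -jB -jpart_mxB mnorm_jpart.
have feta : f <= eta by apply: le_trans abeta; rewrite lerD.
have f0 : 0 <= f by rewrite addr_ge0 ?mnorm_ge0.
have eta0 := le_trans f0 feta; have f1 := le_trans feta eta1.
have keta : eta <= k0 * eta by rewrite ler_peMl.
have kf : f <= k0 * f by rewrite ler_peMl.
have kff : 0 <= k0 * eta * f by rewrite !mulr_ge0.
have aO : first_order eta f k0 a (quatA R, jpart_mx a).
  have nb := mnorm_ge0 (b - quatB R); have njb := mnorm_ge0 (jpart_mx b).
  split=> //=; first by move: abeta keta nb; clear; lra.
  - by rewrite subrr mnorm0.
  - by apply: le_trans kf; rewrite lerDl.
  - by move: nA nB; rewrite /k0; clear; lra.
have bO : first_order eta f k0 b (quatB R, jpart_mx b).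
  have na := mnorm_ge0 (a - quatA R); have nja := mnorm_ge0 (jpart_mx a).
  split=> //=; first by move: abeta keta na; clear; lra.
  - by rewrite subrr mnorm0.
  - by apply: le_trans kf; rewrite lerDr.
  - by move: nA nB; rewrite /k0; clear; lra.
have [AI BI] := (quatA_isoJ R, quatB_isoJ R).
have [x1 [x2 [x3 [x4 [x5 [x6 {}aO]]]]]] :=
  first_order_skew f0 feta eta1 AI aI aO.
have [y1 [y2 [y3 [y4 [y5 [y6 {}bO]]]]]] :=
  first_order_skew f0 feta eta1 BI bI bO.
rewrite -/k1 in aO bO.
have bound s X X0 : isoJ_mx X0 -> first_order eta f k1 X (X0, s * X0) ->
    mnorm s <= k1 ^+ 2 * f.
  move=> [_ X0V] [_ _ /= sX0 X0k _]; rewrite -[s]mulr1 -X0V mulrA.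
  apply: le_trans (mnormM_le sX0 _) (_ : k1 * f * k1 <= _).
    by rewrite mnorm_dag.
  by rewrite le_eqVlt; apply/orP; left; apply/eqP; ring.
have sAf := bound _ _ _ AI aO; have sBf := bound _ _ _ BI bO.
have [z1 [z2 [z3 [z4 [z5 [z6 [xiK [u1 [u2 [u5 [u6 uE]]]] [v1 [v3 vE]]]]]]]]] :=
  slice x1 x2 x3 x4 x5 x6 y1 y2 y3 y4 y5 y6.
move: aO bO sAf sBf xiK uE vE.
set xi := Jm (persym z1 _ _ _ _ _); set sA := Jm (persym x1 _ _ _ _ _).
set sB := Jm (persym y1 _ _ _ _ _) => aO bO sAf sBf xiK uE vE.
have xim : mnorm xi <= m * f.
  apply: le_trans xiK _.
  apply: le_trans (_ : `|Ks| * (2 * k1 ^+ 2 * f) <= _).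
    apply: le_trans (ler_wpM2r _ (ler_norm _)) _.
      by rewrite addr_ge0 ?mnorm_ge0.
    by rewrite ler_wpM2l //; move: sAf sBf; clear; lra.
  have -> : m * f = f + `|Ks| * (2 * k1 ^+ 2 * f) by rewrite /m; ring.
  by rewrite lerDr.
have [g gI gO] := tangent f f0 f1 _ _ _ _ _ _ xim.
exists g; have Kt0 := first_order_ge0 gO.
have gK : mnorm (g - 1) <= Kt * f by case: gO.
have {}gO := first_order_trans f0 feta gO.
have := first_order_conj f0 feta eta1 AI gO aO.
have := first_order_conj f0 feta eta1 BI gO bO.
rewrite /= -/xi uE vE -/k2 => {}bO {}aO.
have rel' := fig8_rel_conj gI rel.
have := first_order_fox f0 feta eta1 aO bO rel'.
rewrite fox_explicit -/Kf => foxK.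
have {}injK := injK u1 u2 u5 u6 v1 v3.
have k2_ge0 := first_order_ge0 aO.
set tA := Jm (persym u1 _ _ _ _ _) in aO injK uE.
set tB := Jm (persym v1 _ _ _ _ _) in bO injK vE.
have tK : mnorm tA + mnorm tB <= `|Kj| * `|Kf| * eta * f.
  apply: le_trans injK _.
  apply: le_trans (ler_wpM2r (mnorm_ge0 _) (ler_norm _)) _.
  rewrite -!mulrA ler_wpM2l //; apply: le_trans foxK _.
  by have := ler_wpM2r (mulr_ge0 eta0 f0) (ler_norm Kf); rewrite !mulrA.
have last X s X0 : mnorm X0 <= k0 -> first_order eta f k2 X (X0, s * X0) ->
    mnorm (jpart_mx X) <= k2 * eta * f + mnorm s * k0.
  move=> X0k [_ /= XsX0 _ _ _]; rewrite -[jpart_mx X](subrK (s * X0)).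
  by rewrite (le_trans (mnormD _ _)) // lerD // mnormM_le.
have la : mnorm (jpart_mx (conjg_mx g a)) <= k2 * eta * f + mnorm tA * k0.
  by apply: last aO; move: nB; rewrite /k0; clear; lra.
have lb : mnorm (jpart_mx (conjg_mx g b)) <= k2 * eta * f + mnorm tB * k0.
  by apply: last bO; move: nA; rewrite /k0; clear; lra.
split=> //.
  apply: le_trans gK _; rewrite ler_wpM2r // ger0_norm //.
  have : 0 <= k0 * (`|Kj| * `|Kf|) by rewrite !mulr_ge0.
  by have := normr_ge0 k2; clear; lra.
apply: le_trans (lerD la lb) _; rewrite (ger0_norm k2_ge0).
have := ler_wpM2r k0_ge0 tK.
have : 0 <= (1 + `|Kt|) * eta * f by rewrite !mulr_ge0 // addr_ge0.
by clear; lra.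
Qed.

End Improvement.

(** * Continuity and existence of a minimum *)
Section Continuity.
Variables (R : realType) (T : topologicalType).
Local Notation M3 := 'M[quat R]_3.
Implicit Types (f g : T -> quat R) (F G : T -> M3).

Lemma continuous_sum (I : Type) (r : seq I) (u : I -> T -> R) :
  (forall i, continuous (u i)) -> continuous (fun x => \sum_(i <- r) u i x).
Proof.
move=> cu; elim: r => [|i r IHr].
  by under eq_fun do rewrite big_nil; move=> x; exact: cvg_cst.
under eq_fun do rewrite big_cons.
by move=> x; apply: cvgD; [exact: cu|exact: IHr].
Qed.

(** Continuity is expressed through the real coordinates, so that it can be used
    on both the representation space and the product space that parametrises
    matrices below. *)
Definition qcontinuous f :=
  [/\ continuous (fun x => qre (f x)), continuous (fun x => qi (f x)),
      continuous (fun x => qj (f x)) & continuous (fun x => qk (f x))].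

Lemma qcontinuousD f g :
  qcontinuous f -> qcontinuous g -> qcontinuous (fun x => f x + g x).
Proof.
move=> [f1 f2 f3 f4] [g1 g2 g3 g4].
by split=> x; apply: cvgD; [exact: f1|exact: g1|exact: f2|exact: g2|
  exact: f3|exact: g3|exact: f4|exact: g4].
Qed.

Lemma qcontinuousN f : qcontinuous f -> qcontinuous (fun x => - f x).
Proof.
move=> [f1 f2 f3 f4].
by split=> x; apply: cvgN; [exact: f1|exact: f2|exact: f3|exact: f4].
Qed.

Lemma qcontinuous_cst (a : quat R) : qcontinuous (fun _ => a).
Proof. by split=> x; exact: cvg_cst. Qed.

Lemma qcontinuousM f g :
  qcontinuous f -> qcontinuous g -> qcontinuous (fun x => f x * g x).
Proof.
have mulE (p q : quat R) : p * q = Quat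
    (qre p * qre q + (- qi p) * qi q + (- qj p) * qj q + (- qk p) * qk q)
    (qre p * qi q + qi p * qre q + qj p * qk q + (- qk p) * qj q)
    (qre p * qj q + (- qi p) * qk q + qj p * qre q + qk p * qi q)
    (qre p * qk q + qi p * qj q + (- qj p) * qi q + qk p * qre q).
  by case: p q => ? ? ? ? [? ? ? ?]; congr Quat; rewrite /= !mulNr.
have dot (p1 p2 p3 p4 q1 q2 q3 q4 : T -> R) :
    continuous p1 -> continuous p2 -> continuous p3 -> continuous p4 ->
    continuous q1 -> continuous q2 -> continuous q3 -> continuous q4 ->
    continuous (fun x => p1 x * q1 x + p2 x * q2 x + p3 x * q3 x + p4 x * q4 x).
  move=> c1 c2 c3 c4 d1 d2 d3 d4 x; apply: cvgD; last exact: cvgM (c4 x) (d4 x).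
  apply: cvgD; last exact: cvgM (c3 x) (d3 x).
  apply: cvgD; first exact: cvgM (c1 x) (d1 x).
  exact: cvgM (c2 x) (d2 x).
have opp (p : T -> R) : continuous p -> continuous (fun x => - p x).
  by move=> cp x; apply: cvgN; exact: cp.
move=> [f1 f2 f3 f4] [g1 g2 g3 g4]; under eq_fun do rewrite mulE.
by split=> /=; apply: dot => //; exact: opp.
Qed.

Lemma qcontinuous_star f : qcontinuous f -> qcontinuous (fun x => star (f x)).
Proof.
move=> [f1 f2 f3 f4]; split=> x; first exact: f1.
- by apply: cvgN; exact: f2.
- by apply: cvgN; exact: f3.
- by apply: cvgN; exact: f4.
Qed.

Lemma qcontinuous_jpart f : qcontinuous f -> qcontinuous (fun x => jpart (f x)).
Proof.
move=> [f1 f2 f3 f4].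
by split=> x; [exact: cvg_cst|exact: cvg_cst|exact: f3|exact: f4].
Qed.

Lemma qcontinuous_qnorm f : qcontinuous f -> continuous (fun x => qnorm (f x)).
Proof.
move=> [f1 f2 f3 f4] x; rewrite /qnorm.
by do 3?apply: cvgD; apply: cvg_norm; [exact: f1|exact: f2|exact: f3|exact: f4].
Qed.

Definition mcontinuous F := forall i j, qcontinuous (fun x => F x i j).

Lemma mcontinuous_cst (X : M3) : mcontinuous (fun _ => X).
Proof. by move=> i j; exact: qcontinuous_cst. Qed.

Lemma mcontinuousB F G :
  mcontinuous F -> mcontinuous G -> mcontinuous (fun x => F x - G x).
Proof.
move=> cF cG i j; have := qcontinuousD (cF i j) (qcontinuousN (cG i j)).
by congr qcontinuous; apply/funext => x; rewrite !mxE.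
Qed.

Lemma mcontinuousM F G :
  mcontinuous F -> mcontinuous G -> mcontinuous (fun x => F x * G x).
Proof.
move=> cF cG i j.
have : qcontinuous (fun x => \sum_(k <- index_enum 'I_3) F x i k * G x k j).
  elim: (index_enum _) => [|k r IHr].
    by under eq_fun do rewrite big_nil; exact: qcontinuous_cst.
  under eq_fun do rewrite big_cons; apply: qcontinuousD IHr.
  exact: qcontinuousM.
by congr qcontinuous; apply/funext => x; rewrite mxE.
Qed.

Lemma mcontinuous_dag F : mcontinuous F -> mcontinuous (fun x => dag (F x)).
Proof.
move=> cF i j; have := qcontinuous_star (cF (rev_ord j) (rev_ord i)).
by congr qcontinuous; apply/funext => x; rewrite mxE.
Qed.

Lemma mcontinuous_jpart F :
  mcontinuous F -> mcontinuous (fun x => jpart_mx (F x)).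
Proof.
move=> cF i j; have := qcontinuous_jpart (cF i j).
by congr qcontinuous; apply/funext => x; rewrite mxE.
Qed.

Lemma mcontinuous_mnorm F :
  mcontinuous F -> continuous (fun x => mnorm (F x)).
Proof.
move=> cF; rewrite /mnorm; apply: continuous_sum => i.
by apply: continuous_sum => j; exact: qcontinuous_qnorm.
Qed.

End Continuity.

Section Minimum.
Variable R : realType.
Local Notation M3 := 'M[quat R]_3.
Local Notation coords := ('I_3 * 'I_3 * 'I_4)%type.
Implicit Types (g : M3).

(** Matrices are parametrised by real functions on a finite set, so that
    Tychonoff's theorem gives compact boxes. *)
Definition mx_of_coords (x : coords -> R) : M3 :=
  \matrix_(i, j) Quat (x (i, j, inord 0)) (x (i, j, inord 1))
                      (x (i, j, inord 2)) (x (i, j, inord 3)).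

Definition coords_of_mx g (c : coords) : R :=
  let q := g c.1.1 c.1.2 in
  nth 0 [:: qre q; qi q; qj q; qk q] c.2.

Lemma coords_of_mxK : cancel coords_of_mx mx_of_coords.
Proof.
move=> g; apply/matrixP => i j; rewrite mxE /coords_of_mx /= !inordK //=.
by case: (g i j).
Qed.

Lemma mx_of_coords_continuous :
  mcontinuous (mx_of_coords : prod_topology (fun _ : coords => R) -> M3).
Proof.
move=> i j; have cp c := @proj_continuous _ (fun _ : coords => R) c.
have ext (u v : prod_topology (fun _ : coords => R) -> R) :
  u =1 v -> continuous v -> continuous u by move=> /funext ->.
by split; [apply: ext (cp (i, j, inord 0))|apply: ext (cp (i, j, inord 1))|
  apply: ext (cp (i, j, inord 2))|apply: ext (cp (i, j, inord 3))] => x;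
  rewrite mxE.
Qed.

Lemma coords_le_mnorm g c : `|coords_of_mx g c| <= mnorm g.
Proof.
case: c => [[i j] k]; apply: le_trans (qnorm_le_mnorm g i j).
rewrite /coords_of_mx /qnorm /=.
have := normr_ge0 (qre (g i j)); have := normr_ge0 (qi (g i j)).
have := normr_ge0 (qj (g i j)); have := normr_ge0 (qk (g i j)).
case: k => [[|[|[|[|//]]]] ?] /=; lra.
Qed.

(** Isometries form a closed set, so those in a box form a compact one; the
    lower bound on [r] puts the identity, of norm 3, among them. *)
Lemma isometry_min (F : M3 -> R) (r : R) : 3 <= r ->
  (forall (T : topologicalType) (G : T -> M3), mcontinuous G ->
     continuous (fun x => F (G x))) ->
  exists g, [/\ isoJ_mx g & forall h, isoJ_mx h -> mnorm h <= r -> F g <= F h].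
Proof.
move=> r3 cF; pose X := prod_topology (fun _ : coords => R).
pose M : X -> M3 := mx_of_coords.
pose B : set X := [set x | forall c, `[- r, r]%classic (x c)].
pose D (x : X) := mnorm (dag (M x) * M x - 1) + mnorm (M x * dag (M x) - 1).
pose S : set X := [set x | D x = 0].
have SP x : S x <-> isoJ_mx (M x).
  rewrite /S /D /isoJ_mx /=; split; last first.
    by move=> [-> ->]; rewrite subrr mnorm0 addr0.
  move/eqP; rewrite paddr_eq0 ?mnorm_ge0 //.
  move=> /andP[/eqP/mnorm0_eq0 e1 /eqP/mnorm0_eq0 e2].
  by split; apply/eqP; rewrite -subr_eq0 ?e1 ?e2.
have cM : mcontinuous M := mx_of_coords_continuous.
have c1 := mcontinuous_cst X 1 : mcontinuous (fun _ : X => 1 : M3).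
have cdM := mcontinuous_dag cM.
have cD1 := mcontinuous_mnorm (mcontinuousB (mcontinuousM cdM cM) c1).
have cD2 := mcontinuous_mnorm (mcontinuousB (mcontinuousM cM cdM) c1).
have cD : continuous D by move=> x; exact: cvgD (cD1 x) (cD2 x).
have cB : compact B.
  apply: (@tychonoff _ (fun _ => R) (fun _ => `[- r, r]%classic)) => c.
  exact: segment_compact.
have closedS : closed S.
  have -> : S = D @^-1` [set 0] by [].
  by apply: closed_comp => [x _|]; [exact: cD|exact: closed_eq].
have cBS : compact (B `&` S).
  apply: (subclosed_compact _ cB); last by move=> x [].
  apply: closedI => //; apply: compact_closed => //.
  exact: hausdorff_product.
have inB h : isoJ_mx h -> mnorm h <= r -> (B `&` S) (coords_of_mx h).
  move=> hI hr; split.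
    move=> c /=; rewrite in_itv /= -ler_norml.
    exact: le_trans (coords_le_mnorm h c) hr.
  by apply/SP; rewrite /M coords_of_mxK.
have [||x xBS xmin] := @compact_EVT_min _ _ (fun x => F (M x)) _ _ cBS.
- by exists (coords_of_mx 1); apply: inB; rewrite ?mnorm1 //; exact: isoJ_mx1.
- by apply: continuous_subspaceT; exact: cF.
exists (M x); split; first by apply/SP; move: xBS; rewrite inE => -[].
move=> h hI hr; have := xmin (coords_of_mx h).
by rewrite /M coords_of_mxK; apply; rewrite inE; exact: inB.
Qed.

End Minimum.

(** * Removing the j-parts *)
Section Straighten.
Variable R : realType.
Local Notation M3 := 'M[quat R]_3.
Implicit Types (a b g h X : M3).

Lemma conjg_mx_near g X : isoJ_mx g -> mnorm (g - 1) <= 1 -> forall X0,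
  mnorm (conjg_mx g X - X0) <=
  16 * mnorm (X - X0) + 5 * mnorm X0 * mnorm (g - 1).
Proof.
move=> gI g1 X0.
have g4 : mnorm g <= 4.
  by rewrite -[g](subrK 1) (le_trans (mnormD _ _)) // mnorm1; lra.
have dg4 : mnorm (dag g) <= 4 by rewrite mnorm_dag.
have -> : conjg_mx g X - X0 = g * (X - X0) * dag g +
    ((g - 1) * X0 * dag g + X0 * dag (g - 1)).
  rewrite /conjg_mx dagB dag1 mulrBl mulrBr !mulrBl mul1r !mulrBr mulr1.
  by rewrite !subrKA.
rewrite (le_trans (mnormD _ _)) // lerD //.
  have := mnormM_le (mnormM_le g4 (lexx (mnorm (X - X0)))) dg4.
  by move/le_trans; apply; lra.
rewrite (le_trans (mnormD _ _)) //.
have := mnormM_le (mnormM_le (lexx (mnorm (g - 1))) (lexx (mnorm X0))) dg4.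
have := mnormM_le (lexx (mnorm X0)) (lexx (mnorm (dag (g - 1)))).
by rewrite mnorm_dag; clear; lra.
Qed.

(** The weight [c = 1 / (16 K)] of the penalty is what makes the step
    profitable: [improvement] moves [g] by at most [4 K f], which costs [f / 4],
    while the j-parts drop from [f] to at most [f / 4].  The threshold [d]
    guarantees that the conjugate by the minimiser is still within [1 / (4 K)]
    of [rho0]. *)
Lemma straighten : exists2 d : R, 0 < d & forall a b,
  isoJ_mx a -> isoJ_mx b -> fig8_rel a b ->
  mnorm (a - quatA R) + mnorm (b - quatB R) <= d ->
  exists g, [/\ isoJ_mx g, jpart_mx (conjg_mx g a) = 0 &
                jpart_mx (conjg_mx g b) = 0].
Proof.
have [K K1 imp] := improvement R.
pose N := mnorm (quatA R) + mnorm (quatB R).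
have N0 : 0 <= N by rewrite addr_ge0 ?mnorm_ge0.
have K0 : 0 < K by rewrite (lt_le_trans _ K1).
(* By [conjg_mx_near], [e * d] bounds the distance from the conjugate by the
   minimiser to [rho0]. *)
pose e := 16 + 80 * K * N.
have e16 : 16 <= e by rewrite lerDl !mulr_ge0 // ltW.
have e0 : 0 < e by rewrite (lt_le_trans _ e16).
pose d := (4 * K * e)^-1; have d0 : 0 < d by rewrite invr_gt0 !mulr_gt0.
have dE : K * (e * d) = 1 / 4.
  by rewrite /d; field; rewrite !gt_eqF.
have Kd : K * d <= 1 / 64.
  have Kd0 : 0 <= K * d by rewrite ltW ?mulr_gt0.
  by have := ler_wpM2r Kd0 e16; move: dE; clear; lra.
have ed : e * d <= 1 / 4.
  rewrite -dE ler_peMl //; first by rewrite ltW ?mulr_gt0.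
exists d => // a b aI bI rel abd.
pose f g := mnorm (jpart_mx (conjg_mx g a)) + mnorm (jpart_mx (conjg_mx g b)).
pose c := (16 * K)^-1; have c0 : 0 < c by rewrite invr_gt0 mulr_gt0.
have cK : c * K = 1 / 16 by rewrite /c; field; rewrite gt_eqF.
have f_ge0 g : 0 <= f g by rewrite addr_ge0 ?mnorm_ge0.
(* The bound 4 leaves room for the isometries at distance at most 1 from the
   identity, which has norm 3. *)
have [||g [gI gmin]] := @isometry_min R (fun g => f g + c * mnorm (g - 1)) 4.
- by lra.
- move=> T G cG.
  have cX X : mcontinuous (fun x : T => jpart_mx (conjg_mx (G x) X)).
    apply: mcontinuous_jpart; apply: mcontinuousM; last exact: mcontinuous_dag.
    by apply: mcontinuousM => //; exact: mcontinuous_cst.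
  have c1 := mcontinuous_mnorm (mcontinuousB cG (mcontinuous_cst T 1)).
  have ca := mcontinuous_mnorm (cX a); have cb := mcontinuous_mnorm (cX b).
  move=> x; apply: cvgD; first exact: (@cvgD _ _ _ _ _ _ _ _ _ (ca x) (cb x)).
  apply: cvgM; first exact: cvg_cst.
  exact: c1.
have f1d : f 1 <= d.
  have jA : jpart_mx (quatA R) = 0 by exact: jpart_Cm.
  have jB : jpart_mx (quatB R) = 0 by exact: jpart_Cm.
  apply: le_trans abd; rewrite /f /conjg_mx dag1 !mul1r !mulr1.
  apply: lerD; [rewrite -[jpart_mx a]subr0 -jA|rewrite -[jpart_mx b]subr0 -jB];
    by rewrite -jpart_mxB mnorm_jpart.
have := gmin 1 (isoJ_mx1 R); rewrite mnorm1 subrr mnorm0 mulr0 addr0 => gmin1.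
have {}gmin1 : f g + c * mnorm (g - 1) <= d.
  by apply: le_trans f1d; apply: gmin1; lra.
have cg0 : 0 <= c * mnorm (g - 1) by rewrite mulr_ge0 ?mnorm_ge0 // ltW.
have fd : f g <= d by move: gmin1 cg0; clear; lra.
have gd : mnorm (g - 1) <= 16 * (K * d).
  have : 16 * K * (c * mnorm (g - 1)) <= 16 * K * d.
    rewrite ler_wpM2l //; first by rewrite mulr_ge0 // ltW.
    by move: gmin1 (f_ge0 g); clear; lra.
  have -> : 16 * K * (c * mnorm (g - 1)) = mnorm (g - 1).
    by rewrite /c; field; rewrite gt_eqF.
  by rewrite mulrA.
have g1 : mnorm (g - 1) <= 1 by move: gd Kd; clear; lra.
have near : mnorm (conjg_mx g a - quatA R) + mnorm (conjg_mx g b - quatB R) <=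
            e * d.
  have := conjg_mx_near a gI g1 (quatA R).
  have := conjg_mx_near b gI g1 (quatB R).
  have := ler_wpM2l N0 gd; move: abd; rewrite /e /N; clear; lra.
have ed1 : e * d <= 1 by move: ed; clear; lra.
have [h [hI h1 hf]] := imp (e * d) _ _ (conjg_mx_isoJ gI aI)
  (conjg_mx_isoJ gI bI) (fig8_rel_conj gI rel) near ed1.
have {}hf : f (h * g) <= f g / 4.
  by rewrite /f !conjg_mx_comp; apply: le_trans hf _; rewrite dE mul1r mulrC.
have hg1 : mnorm (h * g - 1) <= 4 * K * f g + mnorm (g - 1).
  have -> : h * g - 1 = (h - 1) * g + (g - 1) by rewrite mulrBl mul1r subrKA.
  rewrite (le_trans (mnormD _ _)) // lerD2r.
  have g4 : mnorm g <= 4.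
    rewrite -[g](subrK 1) (le_trans (mnormD _ _)) // mnorm1.
    by move: g1; clear; lra.
  apply: le_trans (mnormM_le h1 g4) _; rewrite -/(f g).
  by clear; lra.
have hg4 : mnorm (h * g) <= 4.
  rewrite -[h * g](subrK 1) (le_trans (mnormD _ _)) // mnorm1.
  have := ler_wpM2l (ltW K0) fd; move: hg1 gd Kd; clear; lra.
have := gmin _ (isoJ_mxM hI gI) hg4.
have := ler_wpM2l (ltW c0) hg1.
have -> : c * (4 * K * f g + mnorm (g - 1)) = f g / 4 + c * mnorm (g - 1).
  have -> : c * (4 * K * f g + mnorm (g - 1)) =
            4 * (c * K) * f g + c * mnorm (g - 1) by ring.
  by rewrite cK; field.
move=> I1 I2; have /eqP : f g = 0.
  by apply: le_anti; rewrite f_ge0 andbT; move: I1 I2 hf; clear; lra.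
rewrite paddr_eq0 ?mnorm_ge0 // => /andP[/eqP/mnorm0_eq0 ja /eqP/mnorm0_eq0 jb].
by exists g.
Qed.

End Straighten.

(** * Representations of the figure eight knot group *)
Section Representations.
Variable R : realType.
Local Notation M3 := 'M[quat R]_3.
Local Notation C := R[i].
Implicit Types (a b g h X : M3).

Lemma isoJ_mx_val (g : Sp21 R) : isoJ_mx (val g).
Proof.
rewrite /isoJ_mx -inv_isoJ_mxE; split.
  exact: isometryJ_mulV (valP g).
exact: isometryJ_mulrV (valP g).
Qed.

Lemma isoJ_mx_isometryJ g : isoJ_mx g -> g \in isometryJ (K := quat R).
Proof.
move=> [g1 g2]; apply/isometryJP; split.
  by exists (dag g).
rewrite -(mul1mx (adjmx g)) -formJ2 -!mulmxA.
rewrite (mulmxA (adjmx g)) (mulmxA (formJ _) (adjmx g *m _)).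
rewrite (mulmxA (formJ _) (adjmx g)) -/(inv_isoJ_mx g) inv_isoJ_mxE.
have -> : dag g *m g = 1%:M by exact: g1.
by rewrite mulmx1.
Qed.

Lemma quat_mx_of_complex_inj : injective (@quat_mx_of_complex R).
Proof.
move=> M N /matrixP MN; apply/matrixP => i j; have := MN i j; rewrite !mxE.
by case: (M i j) (N i j) => a b [c d] [-> ->].
Qed.

(** The isometry equations descend to the complex numbers, because the inclusion
    of complex into quaternionic matrices is injective and commutes with
    adjoints. *)
Lemma complex_isometry (Y : Sp21 R) :
  jpart_mx (val Y) = 0 -> range (@U21_Sp21 R) Y.
Proof.
move=> jY; pose re X : 'M[C]_3 := map_mx (fun q => Complex (qre q) (qi q)) X.
have reK X : jpart_mx X = 0 -> quat_mx_of_complex (re X) = X.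
  move=> /matrixP jX; apply/matrixP => i j; have := jX i j; rewrite !mxE.
  by case: (X i j) => a b c d [-> ->].
have jdY : jpart_mx (dag (val Y)) = 0 by rewrite jpart_dag jY dag0.
have [Y1 Y2] := isoJ_mx_val Y.
have one : quat_mx_of_complex (1%:M : 'M[C]_3) = 1%:M by exact: map_mx1.
have MI : re (val Y) \in isometryJ (K := C).
  apply/isometryJP; split.
    exists (re (dag (val Y))); split; apply: quat_mx_of_complex_inj;
      by rewrite one /quat_mx_of_complex map_mxM -!/(quat_mx_of_complex _) !reK.
  have adjE (N : 'M[C]_3) :
      quat_mx_of_complex (adjmx N) = adjmx (quat_mx_of_complex N).
    by apply/matrixP => i j; rewrite !mxE quat_of_complex_star.
  have JE : quat_mx_of_complex (formJ C) = formJ (quat R).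
    by rewrite /quat_mx_of_complex map_mx3 rmorph0 rmorph1.
  apply: quat_mx_of_complex_inj.
  rewrite /quat_mx_of_complex !map_mxM -!/(quat_mx_of_complex _) adjE JE reK //.
  by have /isometryJP[] := valP Y.
exists (Sub (re (val Y)) MI : U21 R) => //.
by apply: val_inj; rewrite /= reK.
Qed.

Lemma Hom8_1 (rho : Hom8 R) : rho 1%g = 1%g.
Proof. by apply: (mulgI (rho 1%g)); rewrite -gmulfM !mulg1. Qed.

Lemma val_Hom8M (rho : Hom8 R) (x y : Gamma8) :
  val (rho (x * y)%g) = val (rho x) * val (rho y).
Proof. by rewrite gmulfM. Qed.

Lemma val_Hom8V (rho : Hom8 R) (x : Gamma8) :
  val (rho (x^-1)%g) = dag (val (rho x)).
Proof.
have <- : ((rho x)^-1)%g = rho (x^-1)%g.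
  by apply: mulg1_eq; rewrite -gmulfM mulgV Hom8_1.
exact: inv_isoJ_mxE.
Qed.

Lemma fig8_relP (rho : Hom8 R) : fig8_rel (val (rho gen_a)) (val (rho gen_b)).
Proof.
pose l : Gamma8 := (gen_b^-1 * gen_a * gen_b * gen_a^-1 * gen_b)%g.
pose r : Gamma8 := (gen_a * (gen_b^-1 * gen_a * gen_b * gen_a^-1))%g.
(* As a word, [l * r^-1] is the relator. *)
have lr : l = r.
  apply: divg1_eq.
  have aV : (gen_a^-1)%g = pres_class [:: fig8_relator] [:: (false, true)].
    exact: pres_invE.
  have bV : (gen_b^-1)%g = pres_class [:: fig8_relator] [:: (true, true)].
    exact: pres_invE.
  have mulE u v : (pres_class [:: fig8_relator] u * pres_class _ v)%g =
    pres_class _ (u ++ v) by exact: pres_mulE.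
  have invE u : ((pres_class [:: fig8_relator] u)^-1)%g =
    pres_class _ (inv_word u) by exact: pres_invE.
  rewrite /l /r aV bV; pose a := (false, false); pose A := (false, true).
  pose b := (true, false); pose B := (true, true).
  rewrite -[gen_a]/(pres_class _ [:: a]) -[gen_b]/(pres_class _ [:: b]).
  rewrite (mulE [:: B] [:: a]) (mulE [:: B; a] [:: b]).
  rewrite (mulE [:: B; a; b] [:: A]) (mulE [:: B; a; b; A] [:: b]).
  rewrite (mulE [:: a] [:: B; a; b; A]) (invE [:: a; B; a; b; A]).
  rewrite (mulE [:: B; a; b; A; b] [:: a; B; A; b; A]).
  apply/pres_classP; apply: (@WeqRel _ _ [::] [::] fig8_relator).
  by rewrite inE.
have : val (rho l) = val (rho r) by rewrite lr.
by rewrite /l /r !val_Hom8M !val_Hom8V.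
Qed.

Lemma entry_continuous (T : topologicalType) (m n : nat) i j :
  continuous (fun M : 'M[T]_(m, n) => M i j).
Proof.
move=> M U /= MU.
exists (fun k l => if (k == i) && (l == j) then U else setT) => [k l|N].
  by case: ifP => [/andP[/eqP-> /eqP->] //|_]; exact: filterT.
by move=> /(_ i j); rewrite !eqxx.
Qed.

Lemma Hom8_mcontinuous :
  mcontinuous (fun rho : Hom8 R => val (rho gen_a)) /\
  mcontinuous (fun rho : Hom8 R => val (rho gen_b)).
Proof.
have comp (S U : topologicalType) (v : Hom8 R -> S) (u : S -> U) :
    continuous v -> continuous u -> continuous (fun rho => u (v rho)).
  by move=> cv cu rho; exact: continuous_comp (cv rho) (cu (v rho)).
have cfst (S U : topologicalType) : continuous (@fst S U).
  by move=> x; exact: cvg_fst.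
have csnd (S U : topologicalType) : continuous (@snd S U).
  by move=> x; exact: cvg_snd.
have cHom : continuous (fun rho : Hom8 R => (rho gen_a, rho gen_b)).
  exact: initial_continuous.
have cval : continuous (fun g : Sp21 R => val g : M3).
  exact: initial_continuous.
have cq : continuous (@quat_coords R) by exact: initial_continuous.
have centry (F : Hom8 R -> Sp21 R) : continuous F ->
    mcontinuous (fun rho => val (F rho)).
  move=> cF i j; have cFij := comp _ _ _ _ (comp _ _ _ _ cF cval)
    (@entry_continuous (quat R) 3 3 i j).
  have cc := comp _ _ _ _ cFij cq.
  have c12 := comp _ _ _ _ cc (@cfst _ _).
  have c1 := comp _ _ _ _ c12 (@cfst _ _).
  split.
  - exact: comp c1 (@cfst _ _).
  - exact: comp c1 (@csnd _ _).
  - exact: comp c12 (@csnd _ _).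
  - exact: comp cc (@csnd _ _).
split; apply: centry.
  exact: comp cHom (@cfst _ _).
exact: comp cHom (@csnd _ _).
Qed.

Lemma image_complex (rho : Hom8 R) (g : Sp21 R) :
  jpart_mx (conjg_mx (val g) (val (rho gen_a))) = 0 ->
  jpart_mx (conjg_mx (val g) (val (rho gen_b))) = 0 ->
  forall x, jpart_mx (conjg_mx (val g) (val (rho x))) = 0.
Proof.
move=> ja jb; have gI := isoJ_mx_val g.
have jM x y : jpart_mx (conjg_mx (val g) (val (rho x))) = 0 ->
    jpart_mx (conjg_mx (val g) (val (rho y))) = 0 ->
    jpart_mx (conjg_mx (val g) (val (rho (x * y)%g))) = 0.
  move=> jx jy; rewrite val_Hom8M conjg_mxM //.
  by rewrite jpart_mxM jx jy mulr0 mul0r addr0.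
have jV x : jpart_mx (conjg_mx (val g) (val (rho x))) = 0 ->
    jpart_mx (conjg_mx (val g) (val (rho (x^-1)%g))) = 0.
  by move=> jx; rewrite val_Hom8V conjg_mx_dag jpart_dag jx dag0.
elim/pres_ind; elim=> [|[s e] u IHu].
  have -> : pres_class _ [::] = 1%g :> Gamma8 by [].
  have [g1 g2] := gI; rewrite Hom8_1.
  have -> : val (1%g : Sp21 R) = 1 by [].
  by rewrite /conjg_mx mulr1 g2; apply/matrixP => i j; rewrite !mxE; case: eqP.
have -> : pres_class [:: fig8_relator] ((s, e) :: u) =
    (pres_class _ [:: (s, e)] * pres_class _ u)%g.
  by rewrite -[RHS]/(pres_mul _ _) pres_mulE.
apply: jM IHu.
have jg : jpart_mx (conjg_mx (val g)
    (val (rho (pres_class [:: fig8_relator] [:: (s, false)])))) = 0.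
  by case: s.
case: e; last exact: jg.
have -> : pres_class [:: fig8_relator] [:: (s, true)] =
    ((pres_class _ [:: (s, false)])^-1)%g.
  by rewrite -[RHS]/(pres_inv _) pres_invE.
exact: jV.
Qed.

End Representations.

Theorem proposition2p1 (R : realType) :
  exists V : set (Hom8 R), nbhs (rho0_Sp21 R) V /\
    forall rho : Hom8 R, V rho ->
      exists g : Sp21 R, forall x : Gamma8,
        range (@U21_Sp21 R) (g * rho x * g^-1)%g.
Proof.
have [d d0 straight] := straighten R.
pose dist (rho : Hom8 R) :=
  mnorm (val (rho gen_a) - quatA R) + mnorm (val (rho gen_b) - quatB R).
exists [set rho | dist rho < d]; split.
  have [ca cb] := Hom8_mcontinuous R.
  have cst X := mcontinuous_cst (Hom8 R) (X : 'M[quat R]_3).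
  have cA := mcontinuous_mnorm (mcontinuousB ca (cst (quatA R))).
  have cB := mcontinuous_mnorm (mcontinuousB cb (cst (quatB R))).
  have cdist : dist @ rho0_Sp21 R --> dist (rho0_Sp21 R).
    exact: (@cvgD _ _ _ _ _ _ _ _ _ (cA _) (cB _)).
  apply: (cvgr_lt _ cdist).
  have aE : val (rho0_Sp21 R gen_a) = quatA R by rewrite /= rho0_aE.
  have bE : val (rho0_Sp21 R gen_b) = quatB R by rewrite /= rho0_bE.
  by rewrite /dist aE bE !subrr mnorm0 addr0.
move=> rho /ltW rhod.
have [g [gI ga gb]] := straight _ _ (isoJ_mx_val (rho gen_a))
  (isoJ_mx_val (rho gen_b)) (fig8_relP rho) rhod.
exists (Sub g (isoJ_mx_isometryJ gI) : Sp21 R) => x; apply: complex_isometry.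
have := @image_complex R rho (Sub g (isoJ_mx_isometryJ gI)) ga gb x.
rewrite !val_isoJM /conjg_mx.
by have -> : val (Sub g (isoJ_mx_isometryJ gI) : Sp21 R)^-1%g = dag g
  by exact: inv_isoJ_mxE.
Qed.
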